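(* Let $\mathcal{M}$ be an arbitrary (not necessarily atomless or atomic) semifinite von Neumann algebra on a complex separable Hilbert space, equipped with a faithful normal semifinite trace $\tau$, and let $E(\mathbb{Z})\subset S(\mathbb{Z})$ be a shift-monotone space. Then $$E(\mathcal{M},\tau):=\{X\in S(\mathcal{M},\tau): \Phi X\in E(\mathbb{Z})\}$$ is a Calkin space, where $\Phi X=\{\mu(2^n,X)\}_{n\in\mathbb{Z}}$.
   Context: $S(\mathcal{M},\tau)$ is the $*$-algebra of $\tau$-measurable operators affiliated with $\mathcal{M}$. For $X\in S(\mathcal{M},\tau)$, $\mu(t,X)=\inf\{\|XP\|: P\in\mathcal{M}\text{ a projection},\ \tau(\mathbf{1}-P)\le t\}$, $t>0$. A Calkin space is a linear subspace $E(\mathcal{M},\tau)$ of $S(\mathcal{M},\tau)$ such that $B\in E(\mathcal{M},\tau)$, $A\in S(\mathcal{M},\tau)$, $\mu(A)\le\mu(B)$ imply $A\in E(\mathcal{M},\tau)$. $S(\mathbb{Z})$ is the space of complex sequences $x=\{x_n\}_{n\in\mathbb{Z}}$ with $\sup_{k\ge n}|x_k|<\infty$ for all $n\in\mathbb{Z}$. For $x\in S(\mathbb{Z})$, $o_n(x)=\sup_{k\ge n}|x_k|$ and $o(x)=\{o_n(x)\}_{n\in\mathbb{Z}}$. The right shift is $(S_+x)_n=x_{n-1}$. A linear subspace $E(\mathbb{Z})\subset S(\mathbb{Z})$ is a shift-monotone space if (1) $x\in S(\mathbb{Z})$, $y\in E(\mathbb{Z})$, $o(x)\le o(y)$ (pointwise)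 imply $x\in E(\mathbb{Z})$; and (2) $S_+x\in E(\mathbb{Z})$ for all $x\in E(\mathbb{Z})$. *)

(* Defs.v *)
From HB Require Import structures.
From mathcomp Require Import all_boot all_order all_algebra.
From mathcomp Require Import sesquilinear complex.
From mathcomp Require Import all_classical all_reals all_analysis.

Set Implicit Arguments.
Unset Strict Implicit.
Unset Printing Implicit Defensive.

Import Order.TTheory GRing.Theory Num.Theory.
Import numFieldNormedType.Exports.
Import ComplexField.

Local Open Scope classical_set_scope.
Local Open Scope complex_scope.
Local Open Scope ring_scope.

(* A complex Hilbert space: a complete normed space over R[i] whose norm comes
   from a scalar product, linear in its first argument. *)
Record hilbertType (R : realType) := Hilbert {
  hilbert_sort :> completeNormedModType R[i];
  hdot : {dot hilbert_sort for Num.conj};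
  hdot_norm : forall x, hdot x x = `|x| ^+ 2 }.

Section VonNeumann.
Variables (R : realType) (H : hilbertType R).
Implicit Types (a b p u : H -> H) (S M D : set (H -> H)).

Definition separable_space : Prop :=
  exists2 D : set H, countable D & dense D.

Definition bounded_operator : set (H -> H) :=
  [set a | linear a /\ continuous a].

(* b is the adjoint of a *)
Definition adjoint a b : Prop := forall x y : H, hdot H (a x) y = hdot H x (b y).

Definition commutant S : set (H -> H) :=
  [set b | bounded_operator b /\ forall a, S a -> a \o b = b \o a].

Definition von_neumann_algebra M : Prop :=
  [/\ M `<=` bounded_operator,
      forall a, M a -> exists2 b, M b & adjoint a b &
      commutant (commutant M) = M].

(* 0 <= z for z : R[i] includes that z is real. *)
Definition positive_part M : set (H -> H) :=
  [set a | M a /\ forall x, 0 <= hdot H (a x) x].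

Definition op_le a b : Prop := forall x, 0 <= hdot H ((b \- a) x) x.

Definition projection M : set (H -> H) :=
  [set p | [/\ M p, p \o p = p & adjoint p p]].

Definition unitary u : Prop :=
  bounded_operator u /\
  exists v, [/\ adjoint u v, u \o v = id & v \o u = id].

Definition upward_directed D : Prop :=
  D !=set0 /\
  forall a b, D a -> D b -> exists c, [/\ D c, op_le a c & op_le b c].

Definition op_lub M D a : Prop :=
  [/\ positive_part M a, forall b, D b -> op_le b a &
      forall c, positive_part M c -> (forall b, D b -> op_le b c) -> op_le a c].

(* A faithful normal semifinite trace is a weight on the positive cone of M;
   the values of tau outside that cone are irrelevant. A von Neumann algebra is
   semifinite exactly when it carries such a tau. *)
Record fns_trace M (tau : (H -> H) -> \bar R) : Prop := {
  trace_ge0 : forall a, positive_part M a -> (0 <= tau a)%E;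
  traceD : forall a b, positive_part M a -> positive_part M b ->
    tau (a \+ b) = (tau a + tau b)%E;
  traceZ : forall (r : R) a, 0 <= r -> positive_part M a ->
    tau (r%:C \*: a) = (r%:E * tau a)%E;
  trace_comm : forall a b, M a -> adjoint a b -> tau (b \o a) = tau (a \o b);
  trace_faithful : forall a, positive_part M a -> tau a = 0%E ->
    forall x, a x = 0;
  trace_normal : forall D a, D `<=` positive_part M -> upward_directed D ->
    op_lub M D a -> tau a = ereal_sup (tau @` D);
  trace_semifinite : forall a, positive_part M a -> (exists x, a x != 0) ->
    exists b, [/\ positive_part M b, exists x, b x != 0, op_le b a &
                  (tau b < +oo)%E] }.

(* Possibly unbounded operators are given by their graphs in H * H. *)
Implicit Types X Y : set (H * H).

Definition op_domain X : set H := [set x | exists y, X (x, y)].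

Record closed_operator X : Prop := {
  graph0 : X (0, 0);
  graph_linear : forall (c : R[i]) x y x' y', X (x, y) -> X (x', y') ->
    X (c *: x + x', c *: y + y');
  graph_functional : forall x y y', X (x, y) -> X (x, y') -> y = y';
  graph_closed : closed X;
  graph_dense : dense (op_domain X) }.

(* u^* X u = X for every unitary u of the commutant *)
Definition affiliated M X : Prop :=
  forall u, commutant M u -> unitary u ->
  forall x y, X (x, y) <-> X (u x, u y).

(* S(M, tau): for every eps > 0, X is everywhere defined on the range of some
   projection p of M with tau(1 - p) <= eps. *)
Definition tau_measurable M (tau : (H -> H) -> \bar R) : set (set (H * H)) :=
  [set X | [/\ closed_operator X, affiliated M X &
     forall eps : R, 0 < eps ->
     exists p, [/\ projection M p, (tau (id \- p)%R <= eps%:E)%E &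
                   forall x, op_domain X (p x)]]].

Definition op_zero : set (H * H) := [set z | z.2 = 0].

(* The operations of the *-algebra S(M, tau) are the strong ones, i.e. the
   closures of the algebraic ones. *)
Definition strong_add X Y : set (H * H) :=
  closure [set z | exists y y', [/\ X (z.1, y), Y (z.1, y') & z.2 = y + y']].

Definition strong_scale (c : R[i]) X : set (H * H) :=
  closure [set z | exists2 y, X (z.1, y) & z.2 = c *: y].

(* The graph of X p *)
Definition op_comp X p : set (H * H) := [set z | X (p z.1, z.2)].

(* +oo unless X is bounded and everywhere defined. For closed X and bounded p,
   X p is closed, so it is everywhere defined as soon as it is bounded on a
   dense domain. *)
Definition op_norm X : \bar R :=
  ereal_inf [set c%:E | c in [set c : R | 0 <= c /\
    forall x, exists2 y, X (x, y) & `|y| <= c%:C * `|x|]].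

Definition mu M (tau : (H -> H) -> \bar R) (t : R) X : \bar R :=
  ereal_inf [set op_norm (op_comp X p) |
    p in [set p | projection M p /\ (tau (id \- p)%R <= t%:E)%E]].

Definition calkin_space M (tau : (H -> H) -> \bar R)
    (E : set (set (H * H))) : Prop :=
  [/\ E `<=` tau_measurable M tau,
      [/\ E op_zero,
          forall X Y, E X -> E Y -> E (strong_add X Y) &
          forall c X, E X -> E (strong_scale c X)] &
      forall A B, E B -> tau_measurable M tau A ->
        (forall t : R, 0 < t -> (mu M tau t A <= mu M tau t B)%E) -> E A].

(* mu is finite at every t > 0 when X is tau-measurable, so that fine loses
   nothing there. *)
Definition Phi M (tau : (H -> H) -> \bar R) X : int -> R[i] :=
  fun n => (fine (mu M tau (2 ^ n) X))%:C.

End VonNeumann.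

Section Sequences.
Variable R : realType.
Implicit Types x y : int -> R[i].

Definition tail_moduli x (n : int) : set R :=
  [set Normc.normc (x k) | k in [set k : int | n <= k]].

(* S(Z) *)
Definition bounded_above_seq : set (int -> R[i]) :=
  [set x | forall n, has_ubound (tail_moduli x n)].

Definition o_seq x (n : int) : R := sup (tail_moduli x n).

Definition right_shift x : int -> R[i] := fun n => x (n - 1).

Definition shift_monotone_space (E : set (int -> R[i])) : Prop :=
  [/\ E `<=` bounded_above_seq,
      E (fun=> 0) /\ (forall (c : R[i]) x y, E x -> E y ->
                        E (fun n => c * x n + y n)),
      forall x y, bounded_above_seq x -> E y ->
        (forall n, o_seq x n <= o_seq y n) -> E x &
      forall x, E x -> E (right_shift x)].

End Sequences.

(* Main.v *)
Require Import Defs.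
From HB Require Import structures.
From mathcomp Require Import all_boot all_order all_algebra.
From mathcomp Require Import sesquilinear complex.
From mathcomp Require Import all_classical all_reals all_analysis.
From mathcomp Require Import ring lra.
Set Implicit Arguments.
Unset Strict Implicit.
Unset Printing Implicit Defensive.

Import Order.TTheory GRing.Theory Num.Theory.
Import numFieldNormedType.Exports.
Import ComplexField.

Local Open Scope classical_set_scope.
Local Open Scope complex_scope.
Local Open Scope ring_scope.

(* The inequality behind closure under sums is
   mu (4 t, X + Y) <= mu (t, X) + mu (t, Y): two applications of the right
   shift then absorb the factor 4 along t = 2^n. The factor 4 in place of the
   usual 2 allows a crude comparison of projections, in which the trace of the
   left support of a contraction T in M is at most twice the trace of any
   projection g of M with T g = T; this follows from
   tau (S' S) = tau (S S'), where S' is the adjoint of S, from polynomials in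
   T T' and from normality, without polar decomposition or functional calculus.
   Applied to T = p (1 - q) it gives e <= p, q in M with
   tau (1 - e) <= tau (1 - p) + 2 tau (1 - q).

   The algebraic sum of X and Y is closable because for every d > 0 there is a
   projection r of M with tau (1 - r) <= d such that r X is bounded: if p
   projects onto vectors on which X is bounded and tau (1 - p) is small, let r
   be the complement of the left support of T, where T maps v to the second
   coordinate of the projection of (v, 0) onto the graph of X restricted to
   ker p. A vector w such that (0, w) is in the closure of the sum is then
   killed by projections of arbitrarily small cotrace, hence w = 0. *)

(** * Real-valued scalar product and norm on a complex Hilbert space *)

Section HilbertCalculus.
Variables (R : realType) (H : hilbertType R).
Implicit Types (x y z : H) (c : R[i]) (r : R).

(** Norms and scalar products take values in [R[i]]; their real parts [rdot] and [hnorm] keep all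
    estimates in [R], within reach of [lra] and [nra]. Nothing is lost, by [hdot_rdot] and
    [normr_hnorm]. *)
Definition rdot x y : R := complex.Re (hdot H x y).
Definition hnorm x : R := complex.Re `|x|.

Lemma hdotC x y : hdot H x y = Num.conj (hdot H y x).
Proof. by rewrite hermC expr0 mul1r. Qed.

Lemma hdotDl x y z : hdot H (x + y) z = hdot H x z + hdot H y z.
Proof. exact: linearDl. Qed.

Lemma hdotZl c x y : hdot H (c *: x) y = c * hdot H x y.
Proof. exact: linearZl_LR. Qed.

Lemma hdotDr x y z : hdot H x (y + z) = hdot H x y + hdot H x z.
Proof. exact: linearDr. Qed.

Lemma hdotZr c x y : hdot H x (c *: y) = Num.conj c * hdot H x y.
Proof. exact: linearZr_LR. Qed.

Lemma rdotC x y : rdot x y = rdot y x.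
Proof. by rewrite /rdot hdotC; case: (hdot H y x). Qed.

Lemma rdotDl x y z : rdot (x + y) z = rdot x z + rdot y z.
Proof. by rewrite /rdot hdotDl; case: (hdot H x z); case: (hdot H y z). Qed.

Lemma rdotDr x y z : rdot x (y + z) = rdot x y + rdot x z.
Proof. by rewrite !(rdotC x) rdotDl. Qed.

Lemma rdotZl r x y : rdot (r%:C *: x) y = r * rdot x y.
Proof.
by rewrite /rdot hdotZl; case: (hdot H x y) => a b /=; rewrite mul0r subr0.
Qed.

Lemma rdotZr r x y : rdot x (r%:C *: y) = r * rdot x y.
Proof. by rewrite !(rdotC x) rdotZl. Qed.

Lemma rdotNl x y : rdot (- x) y = - rdot x y.
Proof.
have -> : - x = (-1)%:C *: x by rewrite rmorphN scaleN1r.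
by rewrite rdotZl mulN1r.
Qed.

Lemma rdotNr x y : rdot x (- y) = - rdot x y.
Proof. by rewrite !(rdotC x) rdotNl. Qed.

Lemma rdot0l x : rdot 0 x = 0.
Proof. by rewrite -(subrr 0) rdotDl rdotNl subrr. Qed.

Lemma rdot0r x : rdot x 0 = 0.
Proof. by rewrite rdotC rdot0l. Qed.

Lemma rdotBl x y z : rdot (x - y) z = rdot x z - rdot y z.
Proof. by rewrite rdotDl rdotNl. Qed.

Lemma rdotBr x y z : rdot x (y - z) = rdot x y - rdot x z.
Proof. by rewrite rdotDr rdotNr. Qed.

Definition rdotE := (rdotDl, rdotDr, rdotNl, rdotNr, rdotZl, rdotZr, rdot0l, rdot0r).

Lemma rdot_iC x y : rdot ('i%C *: x) y = - rdot x ('i%C *: y).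
Proof.
rewrite /rdot hdotZl (hdotC x (_ *: _)) hdotZl (hdotC y).
by case: (hdot H x y) => a b /=; ring.
Qed.

Lemma scale_ii x : 'i%C *: ('i%C *: x) = - x.
Proof. by rewrite scalerA -expr2 sqr_i scaleN1r. Qed.

(** Since <x, iy> = -i <x, y>, the imaginary part of <x, y> is the real part of <x, iy>. *)
Lemma hdot_rdot x y : hdot H x y = rdot x y +i* rdot x ('i%C *: y).
Proof.
rewrite /rdot (hdotC x ('i%C *: y)) hdotZl (hdotC y).
case: (hdot H x y) => a b /=.
by congr (_ +i* _); ring.
Qed.

Lemma normr_hnorm x : `|x| = (hnorm x)%:C.
Proof.
rewrite /hnorm; have : 0 <= `|x| by exact: normr_ge0.
by case: (`|x|) => a b /=; rewrite lecE /= => /andP[/eqP ->].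
Qed.

Lemma hnorm_ge0 x : 0 <= hnorm x.
Proof. by rewrite -lecR -normr_hnorm normr_ge0. Qed.

Lemma rdotxx x : rdot x x = hnorm x ^+ 2.
Proof. by rewrite /rdot hdot_norm normr_hnorm -rmorphXn. Qed.

Lemma hnorm0 : hnorm 0 = 0.
Proof. by rewrite /hnorm normr0. Qed.

Lemma hnorm_eq0 x : hnorm x = 0 -> x = 0.
Proof.
move=> x0; apply/eqP; rewrite -normr_eq0 normr_hnorm x0.
by apply/eqP.
Qed.

Lemma hnorm_leD x y : hnorm (x + y) <= hnorm x + hnorm y.
Proof.
by rewrite -lecR rmorphD /= -!normr_hnorm ler_normD.
Qed.

Lemma hnorm_opp x : hnorm (- x) = hnorm x.
Proof. by rewrite /hnorm normrN. Qed.

Lemma hnormBC x y : hnorm (x - y) = hnorm (y - x).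
Proof. by rewrite -hnorm_opp opprB. Qed.

Lemma hnorm_triangle z x y : hnorm (x - y) <= hnorm (x - z) + hnorm (z - y).
Proof. by rewrite -[x - y](subrKA z) hnorm_leD. Qed.

Lemma hnormZ c x : hnorm (c *: x) = Normc.normc c * hnorm x.
Proof.
apply: (@complexI R); rewrite rmorphM /= -!normr_hnorm normrZ.
by [].
Qed.

Lemma hnormZr r x : hnorm (r%:C *: x) = `|r| * hnorm x.
Proof. by rewrite hnormZ /= expr0n addr0 sqrtr_sqr. Qed.

Lemma rdotxx_ge0 x : 0 <= rdot x x.
Proof. by rewrite rdotxx sqr_ge0. Qed.

Lemma rdotxx_eq0 x : rdot x x = 0 -> x = 0.
Proof. by rewrite rdotxx => /eqP; rewrite sqrf_eq0 => /eqP/hnorm_eq0. Qed.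

(** Reduces a vector identity to scalar ones, which [ring] or [lra] can settle; [hring] packages
    this. *)
Lemma rdot_inj x y : (forall z, rdot x z = rdot y z) -> x = y.
Proof.
move=> xy; apply/subr0_eq/rdotxx_eq0.
by rewrite rdotBl xy subrr.
Qed.

Lemma rdot_congr x y : x = y -> forall z, rdot x z = rdot y z.
Proof. by move=> ->. Qed.

(** Cauchy-Schwarz, obtained by squaring the triangle inequality. *)
Lemma rdot_le x y : rdot x y <= hnorm x * hnorm y.
Proof.
have : hnorm (x + y) ^+ 2 <= (hnorm x + hnorm y) ^+ 2.
  by rewrite ler_pXn2r ?nnegrE ?addr_ge0 ?hnorm_ge0 ?hnorm_leD.
by rewrite -rdotxx !rdotE !rdotxx (rdotC y); nra.
Qed.

Lemma rdot_abs x y : `|rdot x y| <= hnorm x * hnorm y.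
Proof.
by rewrite ler_norml rdot_le lerNl -rdotNl (le_trans (rdot_le _ _)) ?hnorm_opp.
Qed.

Lemma hnorm_le_sq x y : rdot x x <= rdot y y -> hnorm x <= hnorm y.
Proof. by rewrite !rdotxx ler_pXn2r// nnegrE hnorm_ge0. Qed.

Lemma hnorm_sq_le x y : hnorm x <= hnorm y -> rdot x x <= rdot y y.
Proof. by rewrite !rdotxx ler_pXn2r// nnegrE hnorm_ge0. Qed.

Lemma hnorm_small_eq0 x : (forall e : R, 0 < e -> hnorm x <= e) -> x = 0.
Proof.
move=> xe; apply/hnorm_eq0/eqP; rewrite eq_le hnorm_ge0 andbT.
by apply/ler_addgt0Pl => e e0; rewrite addr0 xe.
Qed.

Lemma ball_hnorm x y (e : R) : 0 < e -> ball x e%:C y <-> hnorm (x - y) < e.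
Proof.
by move=> e0; rewrite -ball_normE /ball_ /= normr_hnorm ltcR.
Qed.

Lemma pos_complexP (e : R[i]) : 0 < e -> exists2 r : R, 0 < r & e = r%:C.
Proof.
case: e => a b; rewrite ltcE /= => /andP[/eqP -> a0].
by exists a.
Qed.

Lemma nbhs_hnorm x (A : set H) :
  nbhs x A <-> exists2 e : R, 0 < e & forall y, hnorm (y - x) < e -> A y.
Proof.
split => [/nbhs_ballP[e /= /pos_complexP[r r0 ->] xA]|[e e0 xA]].
  by exists r => // y yx; apply/xA/ball_hnorm => //; rewrite hnormBC.
apply/nbhs_ballP; exists e%:C; first by rewrite /= ltcR.
by move=> y /(ball_hnorm _ _ e0); rewrite hnormBC; exact: xA.
Qed.

Lemma closure_hnorm (A : set (H * H)) x y :
  closure A (x, y) <-> forall e : R, 0 < e ->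
    exists x' y', [/\ A (x', y'), hnorm (x' - x) < e & hnorm (y' - y) < e].
Proof.
split=> [cA e e0|cA B].
  have : nbhs (x, y) ([set z | hnorm (z - x) < e] `*`
                       [set z | hnorm (z - y) < e]).
    by exists ([set z | hnorm (z - x) < e], [set z | hnorm (z - y) < e]) => //;
      split => /=; apply/nbhs_hnorm; exists e.
  by move=> /cA[[x' y'] [Az [/= h1 h2]]]; exists x', y'.
move=> [[U V] [/= /nbhs_hnorm[e e0 eU] /nbhs_hnorm[d d0 dV]] UVB].
have m0 : 0 < Num.min e d by rewrite lt_min e0 d0.
have [x' [y' [Axy]]] := cA _ m0; rewrite !lt_min => /andP[h1 _] /andP[_ h2].
exists (x', y'); split => //; apply: UVB; split; [exact: eU|exact: dV].
Qed.

Lemma dense_hnorm (D : set H) :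
  dense D <-> forall x (e : R), 0 < e -> exists2 d, D d & hnorm (d - x) < e.
Proof.
split=> [Dd x e e0|Dd U [x Ux] oU].
  have /Dd : (ball x e%:C)^° !=set0.
    exists x; apply: nbhsx_ballx; by rewrite ltcR.
  case; first exact: open_interior.
  move=> d [] /interior_subset /(ball_hnorm _ _ e0) xd Ddd.
  by exists d => //; rewrite hnormBC.
have : nbhs x U by apply: open_nbhs_nbhs.
move=> /nbhs_hnorm[e e0 eU]; have [d Ddd xd] := Dd x e e0.
by exists d; split => //; apply: eU.
Qed.

(** Convergence with radii in [R]; the filter notion for vectors enters only in [hnorm_complete],
    which draws on completeness. *)
Definition hcvg (u : nat -> H) l := forall e : R, 0 < e ->
  exists N, forall n, (N <= n)%N -> hnorm (u n - l) < e.

Lemma hnorm_complete (u : nat -> H) :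
  (forall e : R, 0 < e -> exists N, forall m n, (N <= m)%N -> (N <= n)%N ->
     hnorm (u m - u n) < e) ->
  exists l, hcvg u l.
Proof.
move=> uC; have : cvg (u @ \oo).
  apply: cauchy_cvg; apply: cauchy_exP => e /pos_complexP[r r0 ->].
  have [N NP] := uC r r0; exists (u N); exists N => // n /= Nn.
  by apply/ball_hnorm => //; apply: NP.
move=> /cvg_ex[/= l ul]; exists l => e e0.
have /ul : nbhs l [set y | hnorm (y - l) < e] by apply/nbhs_hnorm; exists e.
by move=> [N _ NP]; exists N => n Nn; exact: NP.
Qed.

End HilbertCalculus.

Ltac hring := apply: rdot_inj => ?; rewrite !rdotE; ring.

(** * Riesz representation, orthogonal projections, adjoints and the closed graph theorem *)

Section HilbertTheory.
Variables (R : realType) (H : hilbertType R).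
Implicit Types (x y v : H) (c : R[i]) (r e : R) (a b : H -> H).
Implicit Types (G : set (H * H)) (D W : set H).

Lemma lin0 a : linear a -> a 0 = 0.
Proof.
move=> al; have := al (-1) 0 0.
by rewrite scaler0 addr0 scaleN1r addNr.
Qed.

Lemma linD a : linear a -> forall x y, a (x + y) = a x + a y.
Proof. by move=> al x y; have := al 1 x y; rewrite !scale1r. Qed.

Lemma linZ a : linear a -> forall c x, a (c *: x) = c *: a x.
Proof.
by move=> al c x; have := al c x 0; rewrite (lin0 al) !addr0.
Qed.

Lemma linN a : linear a -> forall x, a (- x) = - a x.
Proof. by move=> al x; have := linZ al (-1) x; rewrite !scaleN1r. Qed.

Lemma linB a : linear a -> forall x y, a (x - y) = a x - a y.
Proof. by move=> al x y; rewrite (linD al) (linN al). Qed.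

Lemma bounded_operatorP a : bounded_operator a <->
  linear a /\ exists2 C : R, 0 <= C & forall x, hnorm (a x) <= C * hnorm x.
Proof.
split=> [[al ac]|[al [C C0 aC]]]; split=> //.
  have /(ac 0) : nbhs (a 0) [set y | hnorm (y - a 0) < 1].
    by apply/nbhs_hnorm; exists 1.
  (* Rescaled to norm e / 2, a vector lies in the ball that is sent into the unit ball; hence the
     constant 2 / e. *)
  rewrite /nbhs /= => /nbhs_hnorm[e e0 he]; exists (2 / e) => [|x].
    by rewrite divr_ge0// ltW.
  have [->|x0] := eqVneq x 0; first by rewrite (lin0 al) hnorm0 mulr0.
  have nx : 0 < hnorm x.
    rewrite lt_def hnorm_ge0 andbT; apply: contra x0 => /eqP/hnorm_eq0 ->.
    by [].
  have k0 : 0 < e / 2 / hnorm x by rewrite !divr_gt0.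
  have := he ((e / 2 / hnorm x)%:C *: x).
  rewrite /= subr0 (linZ al) (lin0 al) subr0 !hnormZr !gtr0_norm//.
  rewrite divfK ?gt_eqF// ltr_pdivrMr// ltr_pMr// ltr1n => /(_ isT) h.
  have -> : hnorm (a x) = 2 / e * hnorm x * (e / 2 / hnorm x * hnorm (a x)).
    by field; rewrite !gt_eqF.
  by rewrite -[leRHS]mulr1 ler_wpM2l ?mulr_ge0 ?invr_ge0 ?hnorm_ge0 ?ltW.
move=> x U /nbhs_hnorm[e e0 eU]; rewrite /nbhs /=; apply/nbhs_hnorm.
exists (e / (C + 1)); first by rewrite divr_gt0// ltr_wpDl.
move=> y yx; apply: eU; rewrite -(linB al).
rewrite (le_lt_trans (aC _))//.
have C1 : 0 < C + 1 by rewrite ltr_wpDl.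
have := hnorm_ge0 (y - x); move: yx; rewrite ltr_pdivlMr//.
by nra.
Qed.

(** The imaginary part comes for free: [a] commutes with multiplication by i, so the real identity
    at i x gives it. *)
Lemma hdot_of_rdot a v w : linear a ->
  (forall x, rdot (a x) v = rdot x w) -> forall x, hdot H (a x) v = hdot H x w.
Proof.
move=> al ab x; rewrite hdotC hdot_rdot [in RHS]hdotC [in RHS]hdot_rdot.
congr (Num.conj (_ +i* _)); first by rewrite rdotC ab rdotC.
by rewrite rdotC -(linZ al) ab rdotC.
Qed.

Lemma adjoint_rdot a b :
  linear a -> (forall x y, rdot (a x) y = rdot x (b y)) -> adjoint a b.
Proof. by move=> al ab x y; apply: hdot_of_rdot. Qed.

Lemma rdot_adjoint a b x y : adjoint a b -> rdot (a x) y = rdot x (b y).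
Proof. by move=> ab; rewrite /rdot ab. Qed.

Lemma adjointC a b : adjoint a b -> adjoint b a.
Proof. by move=> ab x y; rewrite hdotC -ab -hdotC. Qed.

Lemma adjoint_unique a b b' : adjoint a b -> adjoint a b' -> b = b'.
Proof.
move=> ab ab'; apply/funext => x; apply: rdot_inj => z.
by rewrite rdotC -(rdot_adjoint _ _ ab) (rdot_adjoint _ _ ab') rdotC.
Qed.

Lemma adjoint_comp a a' b b' :
  adjoint a a' -> adjoint b b' -> adjoint (a \o b) (b' \o a').
Proof. by move=> aa bb x y /=; rewrite aa bb. Qed.

Lemma hdot_inj x y : (forall z, hdot H x z = hdot H y z) -> x = y.
Proof. by move=> xy; apply: rdot_inj => z; rewrite /rdot xy. Qed.

Lemma adjoint_linear a b : adjoint a b -> linear b.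
Proof.
move=> /adjointC ab c x y; apply: hdot_inj => z.
by rewrite ab !(hdotDl, hdotZl) !ab.
Qed.

Lemma adjoint_bounded a b :
  bounded_operator a -> adjoint a b -> bounded_operator b.
Proof.
move=> /bounded_operatorP[al [C C0 aC]] ab; apply/bounded_operatorP.
split; first exact: adjoint_linear ab.
exists C => // x; have := rdotxx (b x).
rewrite -(rdot_adjoint _ _ ab) => h.
have := rdot_le (a (b x)) x; rewrite h => {}h.
have := aC (b x); have := hnorm_ge0 (b x); have := hnorm_ge0 x.
rewrite le_eqVlt => /orP[/eqP x0|x0].
  move: h; rewrite -x0 !mulr0 => h _ _.
  by rewrite -(ler_pXn2r (ltn0Sn 1)) ?nnegrE ?hnorm_ge0// expr0n.
rewrite le_eqVlt => /orP[/eqP <- _|b0 h2]; first by rewrite mulr_ge0// ltW.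
by rewrite -(ler_pM2l b0) -expr2 (le_trans h)// mulrCA mulrA ler_wpM2r// ltW.
Qed.

Lemma hcvg_rdot (u : nat -> H) l v : hcvg u l ->
  forall e, 0 < e -> exists N, forall n, (N <= n)%N ->
    `|rdot (u n) v - rdot l v| < e.
Proof.
move=> ul e e0; have v1 : 0 < hnorm v + 1 by rewrite ltr_wpDl ?hnorm_ge0.
have [N NP] := ul (e / (hnorm v + 1)) (divr_gt0 e0 v1).
exists N => n /NP; rewrite ltr_pdivlMr// => h.
rewrite -rdotBl (le_lt_trans (rdot_abs _ _))//.
by have := hnorm_ge0 (u n - l); nra.
Qed.

Lemma closure_linear G :
  (forall c x y x' y', G (x, y) -> G (x', y') ->
     G (c *: x + x', c *: y + y')) ->
  forall c x y x' y', closure G (x, y) -> closure G (x', y') ->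
    closure G (c *: x + x', c *: y + y').
Proof.
move=> Gl c x y x' y' /closure_hnorm Gx /closure_hnorm Gx'.
apply/closure_hnorm => e e0; have K0 : 0 < Normc.normc c + 1.
  by rewrite ltr_wpDl//; case: (c) => ? ?; exact: sqrtr_ge0.
have [u [v [Guv ux vy]]] := Gx (e / 2 / (Normc.normc c + 1))
  (divr_gt0 (divr_gt0 e0 (ltr0Sn _ 1)) K0).
have [u' [v' [Guv' ux' vy']]] := Gx' (e / 2) (divr_gt0 e0 (ltr0Sn _ 1)).
have aux s s' t t' : hnorm (s - t) < e / 2 / (Normc.normc c + 1) ->
    hnorm (s' - t') < e / 2 -> hnorm (c *: s + s' - (c *: t + t')) < e.
  rewrite ltr_pdivlMr// => h1 h2.
  rewrite opprD addrACA -scalerBr (le_lt_trans (hnorm_leD _ _))// hnormZ.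
  have := hnorm_ge0 (s - t); have : 0 <= Normc.normc c.
    by case: (c) => ? ?; exact: sqrtr_ge0.
  by lra.
by exists (c *: u + u'), (c *: v + v'); split; [exact: Gl|exact: aux|exact: aux].
Qed.

(** Real scalar product of the Hilbert sum of two copies of [H], where graphs live. It induces the
    product topology, so closedness of a graph is the library's [closed]. *)
Definition dot2 (z w : H * H) : R := rdot z.1 w.1 + rdot z.2 w.2.

Record closed_subspace G : Prop := ClosedSubspace {
  subspace0 : G (0, 0);
  subspace_lin : forall c x y x' y', G (x, y) -> G (x', y') ->
    G (c *: x + x', c *: y + y');
  subspace_closed : closed G }.

Lemma closed_subspaceT : closed_subspace setT.
Proof. by split => //; exact: closedT. Qed.

Lemma closure_subspace G : G (0, 0) ->
  (forall c x y x' y', G (x, y) -> G (x', y') ->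
     G (c *: x + x', c *: y + y')) -> closed_subspace (closure G).
Proof.
move=> G0 Gl; split; [exact: subset_closure|exact: closure_linear|].
exact: closed_closure.
Qed.

(* Minimises |z|^2 - 2 phi z over G by the parallelogram law. *)
Lemma riesz G (phi : H * H -> R) (C : R) : closed_subspace G -> 0 <= C ->
  (forall z w : H * H, phi (z + w) = phi z + phi w) ->
  (forall r (z : H * H), phi (r%:C *: z) = r * phi z) ->
  (forall z : H * H, phi z ^+ 2 <= C * dot2 z z) ->
  exists2 g, G g & forall z : H * H, G z -> phi z = dot2 z g.
Proof.
move=> Gs C0 phiD phiZ phiC; pose J (z : H * H) := dot2 z z - 2 * phi z.
have GD (z w : H * H) r s : G z -> G w -> G (r%:C *: z + s%:C *: w).
  case: z w => [z1 z2] [w1 w2] Gz Gw.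
  apply: (subspace_lin Gs) => //=; rewrite -[s%:C *: w1]addr0.
  by rewrite -[s%:C *: w2]addr0; apply: (subspace_lin Gs) => //; exact: subspace0.
(* With s = |z|^2, the hypothesis gives (2 phi z)^2 <= 4 C s <= (s + C)^2, so 2 phi z <= s + C. *)
have Jlb (z : H * H) : - C <= J z.
  have := phiC z; have : 0 <= dot2 z z by rewrite addr_ge0 ?rdotxx_ge0.
  rewrite /J; set p := phi z; set s := dot2 z z => s0 h.
  rewrite leNgt; apply/negP => h'.
  have h1 : 0 < 2 * p - (s + C) by lra.
  have h2 : 0 < 2 * p + (s + C) by lra.
  by have := mulr_gt0 h1 h2; have := sqr_ge0 (s - C); nra.
pose S := [set J z | z in G].
have Slb : has_lbound S by exists (- C) => _ [z _ <-].
have Sinf : has_inf S.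
  by split => //; exists (J (0, 0)), (0, 0) => //; exact: subspace0.
pose m := inf S.
have mJ (z : H * H) : G z -> m <= J z by move=> Gz; apply: ge_inf => //; exists z.
have /choice[u uP] : forall n : nat, exists z : H * H, G z /\ J z < m + n.+1%:R^-1.
  move=> n; have [_ [z Gz <-] h] : exists2 y, S y & y < m + n.+1%:R^-1.
    by apply: inf_adherent => //; rewrite invr_gt0.
  by exists z.
(* |u_i - u_j|^2 = 2 J u_i + 2 J u_j - 4 J ((u_i + u_j) / 2), where the linear terms cancel and the
   midpoint has J at least m. *)
have par i j : dot2 (u i - u j) (u i - u j) <= 2 * (i.+1%:R^-1 + j.+1%:R^-1).
  have [[Gi Ji] [Gj Jj]] := (uP i, uP j).
  have := mJ _ (GD (u i) (u j) 2^-1 2^-1 Gi Gj); move: Ji Jj.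
  rewrite /J phiD !phiZ /dot2 /= !rdotE.
  rewrite !(rdotC (u j).1 (u i).1) !(rdotC (u j).2 (u i).2).
  by set A := _^-1; set B := j.+1%:R^-1; set m' := m; clearbody A B m'; lra.
have inv_small e : 0 < e -> exists N, forall n, (N <= n)%N ->
    (n.+1%:R^-1 : R) < e.
  move=> e0; exists (Num.truncn e^-1) => n Nn.
  rewrite invf_plt ?posrE// (lt_le_trans (truncnS_gt _))// ler_nat.
  by [].
have cau e : 0 < e -> exists N, forall i j, (N <= i)%N -> (N <= j)%N ->
    dot2 (u i - u j) (u i - u j) < e ^+ 2.
  move=> e0; have e4 : 0 < e ^+ 2 / 4 by rewrite divr_gt0// exprn_gt0.
  have [N NP] := inv_small _ e4; exists N => i j /NP hi /NP hj.
  rewrite (le_lt_trans (par i j))//; move: hi hj.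
  set A := i.+1%:R^-1; set B := j.+1%:R^-1; clearbody A B; lra.
have [g1 ug1] : exists l, hcvg (fun n => (u n).1) l.
  apply: hnorm_complete => e e0; have [N NP] := cau e e0.
  exists N => i j Ni Nj; rewrite -(ltr_pXn2r (ltn0Sn 1)) ?nnegrE ?hnorm_ge0//.
    by rewrite -rdotxx (le_lt_trans _ (NP _ _ Ni Nj))// lerDl rdotxx_ge0.
  exact: ltW.
have [g2 ug2] : exists l, hcvg (fun n => (u n).2) l.
  apply: hnorm_complete => e e0; have [N NP] := cau e e0.
  exists N => i j Ni Nj; rewrite -(ltr_pXn2r (ltn0Sn 1)) ?nnegrE ?hnorm_ge0//.
    by rewrite -rdotxx (le_lt_trans _ (NP _ _ Ni Nj))// lerDr rdotxx_ge0.
  exact: ltW.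
have Gg : G (g1, g2).
  apply: (subspace_closed Gs); apply/closure_hnorm => e e0.
  have [[N1 h1] [N2 h2]] := (ug1 e e0, ug2 e e0).
  exists (u (maxn N1 N2)).1, (u (maxn N1 N2)).2; split.
  - by rewrite -surjective_pairing; have [] := uP (maxn N1 N2).
  - by rewrite h1// leq_maxl.
  - by rewrite h2// leq_maxr.
exists (g1, g2) => // z Gz.
pose d := dot2 z (g1, g2) - phi z; pose s := dot2 z z.
have s0 : 0 <= s by rewrite addr_ge0 ?rdotxx_ge0.
(* First variation of J at g in the direction z. It is computed at u_n, where J is within 1 / (n +
   1) of its infimum; this gap and the two replacements of u_n by g, one per coordinate, cost at
   most e / 4 each. *)
have key t : 0 <= 2 * t * d + t ^+ 2 * s.
  suff h e : 0 < e -> 0 <= e + (2 * t * d + t ^+ 2 * s).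
    by apply/ler_addgt0Pl => e /h.
  move=> e0; have t1 : 0 < 8 * (`|t| + 1) by rewrite mulr_gt0// ltr_wpDl.
  have e4 := divr_gt0 e0 t1.
  have [[N1 h1] [N2 h2]] := (hcvg_rdot z.1 ug1 e4, hcvg_rdot z.2 ug2 e4).
  have e0' : 0 < e / 4 by rewrite divr_gt0.
  have [N3 h3] := inv_small _ e0'.
  pose n := maxn N1 (maxn N2 N3).
  have := h1 n; rewrite leq_maxl => /(_ isT) {}h1.
  have := h2 n; rewrite leq_max leq_max leqnn orbT => /(_ isT) {}h2.
  have := h3 n; rewrite !leq_max leqnn !orbT => /(_ isT) {}h3.
  have [Gn Jn] := uP n.
  have := mJ _ (GD (u n) z 1 t Gn Gz); move: Jn.
  rewrite /J phiD !phiZ /d /s /dot2 /= !rdotE !(rdotC z.1 (u n).1).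
  rewrite !(rdotC z.2 (u n).2) (rdotC z.1) (rdotC z.2).
  move: h1 h2; rewrite !ltr_pdivlMr//.
  set A := rdot _ _; set B := rdot g1 _; set A' := rdot (u n).2 _.
  set B' := rdot g2 _ => h1 h2 h4 h5.
  have h6 : `|t * (A - B)| <= e / 8.
    by rewrite normrM; have := normr_ge0 t; have := normr_ge0 (A - B); nra.
  have h7 : `|t * (A' - B')| <= e / 8.
    by rewrite normrM; have := normr_ge0 t; have := normr_ge0 (A' - B'); nra.
  move: h6 h7; rewrite !ler_norml => /andP[h61 h62] /andP[h71 h72].
  move: h3; set A0 := n.+1%:R^-1; rewrite -/A0 in h4 *.
  by clearbody m A0; clear h1 h2 e4 t1; nra.
have s1 : 0 < s + 1 by rewrite ltr_wpDl.
(* The optimal t would be - d / s; the denominator s + 1 avoids the case s = 0 and still gives a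
   negative value unless d = 0. *)
have := key (- d / (s + 1)).
have -> : 2 * (- d / (s + 1)) * d + (- d / (s + 1)) ^+ 2 * s =
          - (d ^+ 2 * (s + 2) / (s + 1) ^+ 2).
  by field; rewrite gt_eqF.
rewrite oppr_ge0 pmulr_lle0 ?invr_gt0 ?exprn_gt0// => dd.
have : d ^+ 2 <= 0 by have := sqr_ge0 d; nra.
move=> d0; have /eqP : d ^+ 2 = 0 by apply/eqP; rewrite eq_le d0 sqr_ge0.
by rewrite sqrf_eq0 /d subr_eq0 => /eqP ->.
Qed.

Lemma dot2C (z w : H * H) : dot2 z w = dot2 w z.
Proof. by rewrite /dot2 rdotC (rdotC z.2). Qed.

Lemma dot2_cauchy (z w : H * H) : dot2 z w ^+ 2 <= dot2 w w * dot2 z z.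
Proof.
rewrite /dot2 !rdotxx.
have := rdot_abs z.1 w.1; have := rdot_abs z.2 w.2.
have [] : [/\ 0 <= hnorm z.1, 0 <= hnorm z.2, 0 <= hnorm w.1 & 0 <= hnorm w.2].
  by rewrite !hnorm_ge0.
set a := hnorm z.1; set b := hnorm z.2; set a' := hnorm w.1; set b' := hnorm w.2.
set p := rdot _ _; set q := rdot _ _ => a0 b0 a'0 b'0 hq hp.
have : `|q + p| <= a * a' + b * b'.
  by rewrite (le_trans (ler_normD _ _))// lerD.
rewrite -(ler_pXn2r (ltn0Sn 1)) ?nnegrE ?addr_ge0 ?mulr_ge0//.
rewrite real_normK ?num_real// => /le_trans; apply.
have := sqr_ge0 (a * b' - b * a'); nra.
Qed.

(** The projection of z is the Riesz representative in G of the functional [dot2 z]. *)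
Lemma projection_ex G : closed_subspace G ->
  exists P : H * H -> H * H,
    forall z : H * H, G (P z) /\ forall w : H * H, G w -> dot2 z w = dot2 (P z) w.
Proof.
move=> Gs; pose Q (z p : H * H) := G p /\ forall w : H * H, G w -> dot2 z w = dot2 p w.
suff /choice[P PP] : forall z, exists p, Q z p by exists P.
move=> z; rewrite /Q.
have [] := @riesz G (dot2 z) (dot2 z z) Gs.
- by rewrite addr_ge0 ?rdotxx_ge0.
- by move=> u v; rewrite /dot2 /= !rdotE addrACA.
- by move=> r u; rewrite /dot2 /= !rdotE mulrDr.
- by move=> u; rewrite dot2C dot2_cauchy.
by move=> g Gg gP; exists g; split=> // w Gw; rewrite gP// dot2C.
Qed.

(** Riesz on the whole of [H * H], for a functional of the first coordinate only; the first
    coordinate of the representative is the value of the adjoint. *)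
Lemma adjoint_ex a : bounded_operator a ->
  exists2 b, bounded_operator b & adjoint a b.
Proof.
move=> ab; have [al [C C0 aC]] := (bounded_operatorP a).1 ab.
have /choice[b bP] : forall y, exists g, forall x, rdot (a x) y = rdot x g.
  move=> y; have [] := @riesz setT (fun z : H * H => rdot (a z.1) y)
    ((C * hnorm y) ^+ 2) closed_subspaceT.
  - exact: sqr_ge0.
  - by move=> z w; rewrite /= (linD al) rdotE.
  - by move=> r z; rewrite /= (linZ al) rdotE.
  - move=> z; rewrite (@le_trans _ _ ((C * hnorm y) ^+ 2 * rdot z.1 z.1))//.
      rewrite rdotxx -exprMn -[leLHS]real_normK ?num_real//.
      rewrite ler_pXn2r ?nnegrE ?mulr_ge0 ?hnorm_ge0//.
      rewrite (le_trans (rdot_abs _ _))// mulrAC ler_wpM2r ?hnorm_ge0//.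
    by rewrite ler_wpM2l ?sqr_ge0// lerDl rdotxx_ge0.
  move=> g _ gP; exists g.1 => x; rewrite (gP (x, 0))//.
  by rewrite /dot2 /= rdot0l addr0.
have adj : adjoint a b by apply: adjoint_rdot.
by exists b => //; exact: adjoint_bounded adj.
Qed.

(** D is replaced by D x H in [H * H], so that the projection theorem for pairs applies: x minus its
    projection is orthogonal to D, hence zero. *)
Lemma subspace_dense D : D 0 ->
  (forall c x y, D x -> D y -> D (c *: x + y)) ->
  (forall w, (forall d, D d -> rdot w d = 0) -> w = 0) -> dense D.
Proof.
move=> D0 Dl Dw; apply/dense_hnorm => x e e0.
pose G : set (H * H) := [set z | D z.1].
have Gs : closed_subspace (closure G).
  by apply: closure_subspace => // c x1 y1 x2 y2; exact: Dl.
have [P PP] := projection_ex Gs; have [] := PP (x, 0).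
case: (P (x, 0)) => [p q] Gp pP.
have xp : x - p = 0.
  apply: Dw => d Dd; have : closure G (d, 0) by exact: subset_closure.
  by move/pP; rewrite /dot2 /= !rdot0r !addr0 rdotBl => ->; rewrite subrr.
move/closure_hnorm: Gp => /(_ e e0)[d [y [Dd dp _]]].
by exists d => //; rewrite (subr0_eq xp).
Qed.


Lemma pow3_lt e : 0 < e -> exists N, forall n, (N <= n)%N -> (3^-1 : R) ^+ n < e.
Proof.
move=> e0; have /cvgrPdist_lt/(_ e e0) : (fun n => (3^-1 : R) ^+ n) @ \oo --> 0.
  by apply: cvg_expr; rewrite ger0_norm ?invr_ge0// invf_lt1// ltr1n.
by move=> [N _ NP]; exists N => n /NP; rewrite sub0r normrN ger0_norm//.
Qed.

(* Sokal's gliding hump: if w_n in W has norm at least 2 n 3^n, put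
   x_{n+1} = x_n +- 3^-n w_n / |w_n| with the sign that makes
   |<x_{n+1}, w_n>| >= 3^-n |w_n|; the limit x violates the bound. *)
Lemma weakly_bounded W :
  (forall x, exists C : R, forall w, W w -> `|rdot x w| <= C) ->
  exists C : R, forall w, W w -> hnorm w <= C.
Proof.
move=> Wb; apply: contrapT => /forallNP nW.
have /choice[w wP] : forall n : nat, exists w, W w /\ 2 * n.+1%:R * 3 ^+ n < hnorm w.
  move=> n; have /existsNP[w] := nW (2 * n.+1%:R * 3 ^+ n).
  by move=> /not_implyP[Ww /negP]; rewrite -ltNge; exists w.
have w0 n : 0 < hnorm (w n).
  have [_] := wP n; apply: le_lt_trans; rewrite mulr_ge0// exprn_ge0//.
pose s n x : R := if 0 <= rdot x (w n) then 1 else -1.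
pose step n x := x + (s n x * 3^-1 ^+ n / hnorm (w n))%:C *: w n.
pose X := fix X n := if n is n'.+1 then step n' (X n') else 0.
have s1 n x : `|s n x| = 1 by rewrite /s; case: ifP; rewrite ?normrN normr1.
have p3 n : 0 < (3^-1 : R) ^+ n by rewrite exprn_gt0// invr_gt0.
have Xstep n : hnorm (X n.+1 - X n) = 3^-1 ^+ n.
  rewrite /= /step addrC addKr hnormZr !normrM s1 mul1r normfV.
  rewrite !(ger0_norm (ltW (p3 _))) !(ger0_norm (hnorm_ge0 _)).
  by rewrite divfK// gt_eqF.
(* The right-hand side is the exact sum of 3^-j over n <= j < n + k. *)
have Xd n k : hnorm (X (n + k)%N - X n) <= 3 / 2 * (3^-1 ^+ n - 3^-1 ^+ (n + k)).
  elim: k => [|k IH]; first by rewrite addn0 !subrr hnorm0 mulr0.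
  rewrite (le_trans (hnorm_triangle (X (n + k)%N) _ _))// addnS Xstep.
  by rewrite (exprS _ (n + k)); lra.
have Xd' n k : hnorm (X (n + k)%N - X n) <= 3 / 2 * 3^-1 ^+ n.
  by rewrite (le_trans (Xd n k))// ler_wpM2l ?divr_ge0// gerBl ltW.
have [x Xx] : exists x, hcvg X x.
  apply: hnorm_complete => e e0.
  have e3 : 0 < e / 3 by rewrite divr_gt0.
  have [N NP] := pow3_lt e3; exists N => m n Nm Nn.
  rewrite (le_lt_trans (hnorm_triangle (X N) _ _))// (hnormBC (X N)).
  have := Xd' N (m - N)%N; have := Xd' N (n - N)%N; rewrite !subnKC//.
  by have := NP N (leqnn N); lra.
have xX n : hnorm (x - X n) <= 3 / 2 * 3^-1 ^+ n.
  suff h e : 0 < e -> hnorm (x - X n) <= 3 / 2 * 3^-1 ^+ n + e.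
    by apply/ler_addgt0Pr => e /h.
  move=> e0; have [N NP] := Xx e e0.
  rewrite (le_trans (hnorm_triangle (X (n + N)%N) _ _))// addrC.
  by rewrite lerD// ?Xd'// hnormBC ltW// NP// leq_addl.
have Xw n : 3^-1 ^+ n * hnorm (w n) <= `|rdot (X n.+1) (w n)|.
  rewrite /= /step rdotDl rdotZl rdotxx.
  have -> : s n (X n) * 3^-1 ^+ n / hnorm (w n) * hnorm (w n) ^+ 2 =
    s n (X n) * (3^-1 ^+ n * hnorm (w n)).
    by rewrite expr2 mulrA divfK ?gt_eqF// mulrA.
  have : 0 < 3^-1 ^+ n * hnorm (w n) by rewrite mulr_gt0.
  rewrite /s; case: ifP => [p q|/negbT]; first by rewrite mul1r ger0_norm; lra.
  by rewrite -ltNge => p q; rewrite mulN1r ltr0_norm; lra.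
(* The steps after the n-th move x by at most (3 / 2) 3^-(n+1) = 3^-n / 2, so at least half of 3^-n
   |w_n|, hence n + 1, survives in the limit. *)
have xw n : n.+1%:R <= `|rdot x (w n)|.
  have -> : rdot x (w n) = rdot (X n.+1) (w n) + rdot (x - X n.+1) (w n).
    by rewrite rdotBl addrC subrK.
  have h1 := Xw n; have h2 := rdot_abs (x - X n.+1) (w n).
  have h3 := xX n.+1; rewrite exprS in h3.
  have h4 : hnorm (x - X n.+1) * hnorm (w n) <=
      2^-1 * (3^-1 ^+ n * hnorm (w n)).
    rewrite mulrA ler_wpM2r ?hnorm_ge0// (le_trans h3)//.
    by rewrite mulrA; lra.
  have [_ h5] := wP n.
  have h6 : 2 * n.+1%:R <= 3^-1 ^+ n * hnorm (w n).
    rewrite [leRHS]mulrC exprVn ler_pdivlMr ?exprn_gt0//.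
    exact: ltW.
  have := lerB_normD (rdot (X n.+1) (w n)) (rdot (x - X n.+1) (w n)).
  move: h1 h2 h4 h6; set A := _ * hnorm (w n).
  set p := `|_|; set q := `|_|; set t := `|_|; set N := n.+1%:R.
  set K := _ * _; clearbody A p q t N K.
  by lra.
have [C CP] := Wb x.
have [n Cn] : exists n : nat, C < n.+1%:R.
  by exists (Num.truncn C); rewrite truncnS_gt.
have := CP _ (wP n).1.
by move/(le_trans (xw n))/(lt_le_trans Cn); rewrite ltxx.
Qed.

(** The domain D of the adjoint of [a] is dense because the graph is closed. The adjoint maps the
    unit ball of D to a set W that is weakly bounded, by |a x| at x, hence bounded by some C. So <a
    x, v> <= C |x| |v| for v in D, and density lets v tend to a x. *)
Lemma closed_graph_theorem a :
  linear a -> closed [set z : H * H | z.2 = a z.1] -> bounded_operator a.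
Proof.
move=> al ac; pose G := [set z : H * H | z.2 = a z.1].
have Gs : closed_subspace G.
  split=> //=; first by rewrite /G /= lin0.
  by rewrite /G /= => c x y x' y' -> ->; rewrite al.
pose D := [set v | exists w, forall x, rdot (a x) v = rdot x w].
have Dd : dense D.
  apply: subspace_dense; first by exists 0 => x; rewrite !rdot0r.
    move=> c x y [w wP] [w' wP']; exists (c *: w + w') => u.
    have {}wP := hdot_of_rdot al wP; have {}wP' := hdot_of_rdot al wP'.
    by rewrite /rdot !(hdotDr, hdotZr) wP wP'.
  (* Let w be orthogonal to D and (s, t) the projection of (0, w) onto the graph. Orthogonality of
     the residue puts w - t in D, so <w, w - t> = 0, while <w, t> = |s|^2 + |t|^2. Hence t = w and s
     = 0, and w = a 0 = 0. *)
  move=> w wD; have [P /(_ (0, w))] := projection_ex Gs.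
  case: (P _) => [s t] [st PP]; rewrite /G /= in st.
  have Dw : D (w - t).
    exists s => x; have := PP (x, a x) erefl.
    rewrite /dot2 /= rdot0l add0r (rdotC w) (rdotC t) (rdotC s) rdotBr => ->.
    by rewrite addrK.
  have h1 := wD _ Dw; have h2 := PP (s, t) st.
  have h4 : t = w.
    apply/esym/subr0_eq/rdotxx_eq0.
    move: h1 h2; rewrite /dot2 /= !rdotE (rdotC t w) => h1 h2.
    have := rdotxx_ge0 s; have := rdotxx_ge0 (w - t).
    by rewrite !rdotE (rdotC t w); lra.
  have s0 : s = 0.
    apply: rdotxx_eq0; move: h2; rewrite h4 /dot2 /= rdot0l => h2.
    by lra.
  by rewrite -h4 st s0 lin0.
pose W := [set w | exists2 v, hnorm v <= 1 & forall x, rdot (a x) v = rdot x w].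
have [C CP] : exists C : R, forall w, W w -> hnorm w <= C.
  apply: weakly_bounded => x; exists (hnorm (a x)) => w [v v1 vP].
  rewrite -vP (le_trans (rdot_abs _ _))// -[leRHS]mulr1.
  by rewrite ler_wpM2l ?hnorm_ge0.
have C0 : 0 <= C.
  rewrite -(@hnorm0 _ H) CP//; exists 0; rewrite ?hnorm0// => x.
  by rewrite !rdot0r.
have key x v : D v -> rdot (a x) v <= C * hnorm x * hnorm v.
  move=> [w vP]; have [->|v0] := eqVneq v 0; first by rewrite rdot0r hnorm0 mulr0.
  have nv : 0 < hnorm v.
    by rewrite lt_def hnorm_ge0 andbT; apply: contra v0 => /eqP/hnorm_eq0 ->.
  have : W ((hnorm v)^-1%:C *: w).
    exists ((hnorm v)^-1%:C *: v) => [|y].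
      by rewrite hnormZr gtr0_norm ?invr_gt0// mulVf// gt_eqF.
    by rewrite !rdotZr vP.
  move=> /CP; rewrite hnormZr gtr0_norm ?invr_gt0// => h.
  rewrite vP (le_trans (rdot_le _ _))// mulrC mulrAC ler_wpM2r ?hnorm_ge0//.
  by move: h; rewrite mulrC ler_pdivrMr.
apply/bounded_operatorP; split => //; exists C => // x.
have [->|ax0] := eqVneq (a x) 0; first by rewrite hnorm0 mulr_ge0// hnorm_ge0.
have nv : 0 < hnorm (a x).
  by rewrite lt_def hnorm_ge0 andbT; apply: contra ax0 => /eqP/hnorm_eq0 ->.
rewrite -(ler_pM2r nv) -expr2 -rdotxx.
suff h e : 0 < e -> rdot (a x) (a x) <= C * hnorm x * hnorm (a x) + e.
  by apply/ler_addgt0Pr => e /h.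
(* Replacing a x by v costs |a x| |v - a x| on the left and C |x| |v - a x| on the right; K is the
   sum of these factors. *)
have K0 : 0 < C * hnorm x + hnorm (a x) by rewrite ltr_wpDl// mulr_ge0// hnorm_ge0.
move=> e0; have [v Dv] := (dense_hnorm D).1 Dd (a x) _ (divr_gt0 e0 K0).
rewrite ltr_pdivlMr// => h1.
have h2 := key x v Dv.
have -> : rdot (a x) (a x) = rdot (a x) v - rdot (a x) (v - a x).
  by rewrite rdotBr opprB addrC subrK.
have h3 := rdot_abs (a x) (v - a x).
have h4 := ler_norm (- rdot (a x) (v - a x)); rewrite normrN in h4.
have h5 : hnorm v <= hnorm (a x) + hnorm (v - a x).
  by rewrite -{1}(subrK (a x) v) addrC hnorm_leD.
have h6 : C * hnorm x * hnorm v <= C * hnorm x * (hnorm (a x) + hnorm (v - a x)).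
  by rewrite ler_wpM2l// mulr_ge0// hnorm_ge0.
by lra.
Qed.

End HilbertTheory.

(** * Algebra operations in M and membership tested on unitaries of the commutant *)

Section VonNeumannAlgebra.
Variables (R : realType) (H : hilbertType R) (M : set (H -> H)).
Hypothesis HM : von_neumann_algebra M.
Implicit Types (a b h p u : H -> H) (x y v : H) (c : R[i]) (r e : R).

Lemma bounded_id : bounded_operator (id : H -> H).
Proof.
by apply/bounded_operatorP; split => //; exists 1 => // x; rewrite mul1r.
Qed.

Lemma bounded_comp a b :
  bounded_operator a -> bounded_operator b -> bounded_operator (a \o b).
Proof.
move=> /bounded_operatorP[al [C C0 aC]] /bounded_operatorP[bl [C' C'0 bC]].
apply/bounded_operatorP; split=> [c x y|]; first by rewrite /= bl al.
exists (C * C') => [|x]; first exact: mulr_ge0.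
by rewrite -mulrA (le_trans (aC _))// ler_wpM2l.
Qed.

Lemma boundedD a b :
  bounded_operator a -> bounded_operator b -> bounded_operator (a \+ b).
Proof.
move=> /bounded_operatorP[al [C C0 aC]] /bounded_operatorP[bl [C' C'0 bC]].
apply/bounded_operatorP; split=> [c x y|].
  by rewrite /= bl al scalerDr addrACA.
exists (C + C') => [|x]; first exact: addr_ge0.
by rewrite mulrDl (le_trans (hnorm_leD _ _))// lerD.
Qed.

Lemma boundedZ c a : bounded_operator a -> bounded_operator (c \*: a).
Proof.
move=> /bounded_operatorP[al [C C0 aC]].
have c0 : 0 <= Normc.normc c by case: (c) => ? ?; exact: sqrtr_ge0.
apply/bounded_operatorP; split=> [d x y|].
  by rewrite /= al scalerDr !scalerA mulrC.
exists (Normc.normc c * C) => [|x]; first exact: mulr_ge0.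
by rewrite hnormZ -mulrA ler_wpM2l.
Qed.

Lemma vn_bounded a : M a -> bounded_operator a.
Proof. by have [MB _ _] := HM; exact: MB. Qed.

Lemma vn_linear a : M a -> linear a.
Proof. by move=> /vn_bounded[]. Qed.

Lemma vn_adjoint a : M a -> exists2 b, M b & adjoint a b.
Proof. by have [_ + _] := HM; apply. Qed.

Lemma vn_adjoint_in a b : M a -> adjoint a b -> M b.
Proof. by move=> /vn_adjoint[b' Mb' ab' ab]; rewrite (adjoint_unique ab ab'). Qed.

(** The bicommutant condition as a membership test: the closure properties of M below follow by
    commuting with M'. *)
Lemma vnP a : M a <-> bounded_operator a /\
  forall b, commutant M b -> forall x, b (a x) = a (b x).
Proof.
have [_ _ MM] := HM; rewrite -{1}MM; split=> [[ab aM]|[ab aM]]; split=> // b Mb.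
  by move=> x; have := aM b Mb => /(congr1 (@^~ x)).
by apply/funext => x; exact: aM.
Qed.

Lemma vn_commute a b : M a -> commutant M b -> forall x, b (a x) = a (b x).
Proof. by move=> /vnP[_ + Mb]; apply. Qed.

Lemma commutant_linear b : commutant M b -> linear b.
Proof. by case=> -[]. Qed.

Lemma vn_id : M id.
Proof. by apply/vnP; split=> //; exact: bounded_id. Qed.

Lemma vn_comp a b : M a -> M b -> M (a \o b).
Proof.
move=> Ma Mb; apply/vnP; split=> [|d Md x].
  by apply: bounded_comp; exact: vn_bounded.
by rewrite /= (vn_commute Ma Md) (vn_commute Mb Md).
Qed.

Lemma vnD a b : M a -> M b -> M (a \+ b).
Proof.
move=> Ma Mb; apply/vnP; split=> [|d Md x].
  by apply: boundedD; exact: vn_bounded.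
by rewrite /= (linD (commutant_linear Md)) (vn_commute Ma Md) (vn_commute Mb Md).
Qed.

Lemma vnZ c a : M a -> M (c \*: a).
Proof.
move=> Ma; apply/vnP; split=> [|d Md x].
  by apply: boundedZ; exact: vn_bounded.
by rewrite /= (linZ (commutant_linear Md)) (vn_commute Ma Md).
Qed.

Lemma vnB a b : M a -> M b -> M (a \- b).
Proof.
move=> Ma Mb; have -> : a \- b = a \+ ((-1) \*: b).
  by apply/funext => x /=; rewrite scaleN1r.
by apply: vnD => //; exact: vnZ.
Qed.

Lemma commutant_adjoint b b' : commutant M b -> adjoint b b' -> commutant M b'.
Proof.
move=> Mb bb'; split=> [|a Ma].
  by apply: adjoint_bounded bb'; case: Mb.
have [a' Ma' aa'] := vn_adjoint Ma; have a'a := adjointC aa'.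
apply/funext => x; apply: rdot_inj => y /=.
rewrite (rdot_adjoint _ _ aa') (rdot_adjoint _ _ (adjointC bb')).
rewrite (rdot_adjoint _ _ (adjointC bb')) (rdot_adjoint _ _ aa').
by rewrite (vn_commute Ma' Mb).
Qed.

Lemma unitaryP u : unitary u -> (forall x y, rdot (u x) (u y) = rdot x y) /\
  exists v : H -> H, adjoint u v /\ cancel v u /\ cancel u v.
Proof.
move=> [ub [v [uv uK vK]]]; split=> [x y|].
  rewrite (rdot_adjoint _ _ uv); congr rdot.
  by have /(congr1 (@^~ y)) := vK.
exists v; split=> //; split=> x.
  by have /(congr1 (@^~ x)) := uK.
by have /(congr1 (@^~ x)) := vK.
Qed.

Lemma unitary_hnorm u x : unitary u -> hnorm (u x) = hnorm x.
Proof.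
move=> /unitaryP[uu _]; apply/eqP; rewrite eq_le.
by apply/andP; split; apply: hnorm_le_sq; rewrite uu.
Qed.

(** * The Cayley transform of a bounded self-adjoint operator *)

Section Cayley.
Variable h : H -> H.
Hypotheses (hb : bounded_operator h) (hs : adjoint h h).

Let hl : linear h. Proof. by case: hb. Qed.
Let hsr x y : rdot (h x) y = rdot x (h y). Proof. exact: rdot_adjoint. Qed.

Let hi x y : rdot ('i%C *: h x) y = - rdot x ('i%C *: h y).
Proof. by rewrite rdot_iC hsr (linZ hl). Qed.

Lemma graph_closed_bounded : closed_subspace [set z : H * H | z.2 = h z.1].
Proof.
have [_ [C C0 hC]] := (bounded_operatorP h).1 hb.
split=> /=; first by rewrite lin0.
  by move=> c x y x' y' -> ->; rewrite hl.
case=> x y /closure_hnorm cl /=; apply/subr0_eq/hnorm_small_eq0 => e e0.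
have C1 : 0 < C + 1 by rewrite ltr_wpDl.
have [x' [y' [/= -> xx yy]]] := cl _ (divr_gt0 e0 C1).
rewrite (le_trans (hnorm_triangle (h x') _ _))// -(linB hl) (hnormBC y).
have := hC (x' - x); move: xx yy; rewrite !ltr_pdivlMr//; nra.
Qed.

(** Project (v, 0) onto the graph of h, at (s, h s). Orthogonality of the residue to (x, h x) reads
    <v - s, x> = <h s, h x>, that is v - s = h (h s). *)
Lemma one_plus_square_onto v : exists s, v = s + h (h s).
Proof.
have [P /(_ (v, 0))] := projection_ex graph_closed_bounded.
case: (P _) => [s t] [/= -> PP]; exists s; apply: rdot_inj => x.
have := PP (x, h x) erefl; rewrite /dot2 /= rdot0l addr0 => ->.
by rewrite rdotDl -hsr.
Qed.

(** (1 - ih) (1 + ih) = 1 + h^2, which is onto. *)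
Lemma one_minus_ih_onto v : exists y, y - 'i%C *: h y = v.
Proof.
have [s ->] := one_plus_square_onto v; exists (s + 'i%C *: h s).
by rewrite (linD hl) (linZ hl) scalerDr scale_ii; hring.
Qed.

(** ih is skew for the real scalar product, so a fixed vector d of ih has |d|^2 = - |d|^2. *)
Lemma one_minus_ih_inj x y : x - 'i%C *: h x = y - 'i%C *: h y -> x = y.
Proof.
move=> xy; apply/subr0_eq/rdotxx_eq0; set d := x - y.
have dE : d = 'i%C *: h d.
  apply: rdot_inj => z; have := rdot_congr xy z.
  by rewrite /d (linB hl) scalerBr !rdotE; lra.
have h1 := hi d d; rewrite -dE in h1.
by have := rdotxx_ge0 d; lra.
Qed.

(* The Cayley transform u = (1 + ih) (1 - ih)^-1 = 2 (1 - ih)^-1 - 1 *)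
Lemma cayley : exists u : H -> H, [/\ linear u,
  forall x, u (x - 'i%C *: h x) = x + 'i%C *: h x &
  forall x y, rdot (u x) (u y) = rdot x y].
Proof.
have /choice[S SP] : forall v, exists y, y - 'i%C *: h y = v.
  exact: one_minus_ih_onto.
have SK x : S (x - 'i%C *: h x) = x.
  by apply: one_minus_ih_inj; rewrite SP.
have Sl : linear S.
  move=> c x y; apply: one_minus_ih_inj; rewrite SP hl scalerDr.
  rewrite opprD addrACA SP; congr (_ + _).
  by rewrite scalerA mulrC -scalerA -scalerBr SP.
exists (fun v => 2%:C *: S v - v); split=> [c x y|x|x y].
- rewrite Sl scalerDr opprD addrACA scalerBr; congr (_ + _ + _).
  by rewrite !scalerA mulrC.
- by rewrite SK; hring.
- rewrite -{2}(SP x) -{2}(SP y) -{4}(SP x) -{4}(SP y).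
  move: (S x) (S y) => {}x {}y.
  by rewrite !rdotE (hi x y); ring.
Qed.

End Cayley.

Lemma adjointN h : linear h -> adjoint h h -> adjoint (-%R \o h) (-%R \o h).
Proof.
move=> hl hs; apply: adjoint_rdot => [c x y|x y] /=.
  by rewrite hl opprD scalerN.
by rewrite rdotNl rdotNr (rdot_adjoint _ _ hs).
Qed.

Lemma boundedN h : bounded_operator h -> bounded_operator (-%R \o h).
Proof.
move=> /bounded_operatorP[hl [C C0 hC]]; apply/bounded_operatorP.
split=> [c x y|]; first by rewrite /= hl opprD scalerN.
by exists C => // x; rewrite /= hnorm_opp.
Qed.

(** The transform of -h inverts that of h, whence unitarity. Each of h and u determines the other,
    so the same linear maps commute with both. *)
Lemma cayley_unitary h : bounded_operator h -> adjoint h h ->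
  exists2 u, unitary u & forall a, linear a ->
    (forall x, a (h x) = h (a x)) <-> (forall x, a (u x) = u (a x)).
Proof.
move=> hb hs; have hl : linear h by case: hb.
have [u [ul uE uu]] := cayley hb hs.
have [v [vl vE vv]] := cayley (boundedN hb) (adjointN hl hs).
have uK x : u (v x) = x.
  have [y <-] := one_minus_ih_onto (boundedN hb) (adjointN hl hs) x.
  by rewrite vE /= !scalerN opprK uE.
have vK x : v (u x) = x.
  have [y <-] := one_minus_ih_onto hb hs x.
  by have := vE y; rewrite uE /= !scalerN opprK.
exists u.
  split.
    apply/bounded_operatorP; split=> //; exists 1 => // x; rewrite mul1r.
    by apply: hnorm_le_sq; rewrite uu.
  exists v; split; [|exact/funext|exact/funext].
  by apply: adjoint_rdot => // x y; rewrite -[in LHS](uK y) uu.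
move=> a al; split=> ah x.
  have [y <-] := one_minus_ih_onto hb hs x.
  by rewrite uE (linB al) (linD al) (linZ al) ah uE.
have := ah (x - 'i%C *: h x); rewrite uE (linB al) (linD al) (linZ al).
(* To recover h from u: y - ih y = a x - i a h x, and commutation with u gives y + ih y = a x + i a
   h x. Adding yields y = a x, subtracting yields ih (a x) = i a (h x). *)
have [y yE] := one_minus_ih_onto hb hs (a x - 'i%C *: a (h x)).
rewrite -yE uE => h2.
have h3 : y = a x.
  apply: rdot_inj => z; have := rdot_congr yE z.
  by have := rdot_congr h2 z; rewrite !rdotE; lra.
have h4 : 'i%C *: a (h x) = 'i%C *: h (a x).
  apply: rdot_inj => z; have := rdot_congr h2 z.
  by rewrite h3 !rdotE; lra.
by apply: oppr_inj; rewrite -!scale_ii h4.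
Qed.

Lemma commutantD b b' : commutant M b -> commutant M b' -> commutant M (b \+ b').
Proof.
move=> Mb Mb'; split=> [|a Ma]; first by apply: boundedD; [case: Mb|case: Mb'].
apply/funext => x /=; rewrite (linD (vn_linear Ma)).
by rewrite (vn_commute Ma Mb) (vn_commute Ma Mb').
Qed.

Lemma commutantZ c b : commutant M b -> commutant M (c \*: b).
Proof.
move=> Mb; split=> [|a Ma]; first by apply: boundedZ; case: Mb.
by apply/funext => x /=; rewrite (linZ (vn_linear Ma)) (vn_commute Ma Mb).
Qed.

(* The commutant is spanned by its unitaries. *)
Lemma vn_of_unitaries a : bounded_operator a ->
  (forall u, commutant M u -> unitary u -> forall x, u (a x) = a (u x)) -> M a.
Proof.
move=> ab aU; apply/vnP; split=> // b Mb x; have al : linear a by case: ab.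
(* Every d in M commutes with h, hence with its Cayley transform u. So u lies in M', [a] commutes
   with u by hypothesis, and therefore with h. *)
have sa h : commutant M h -> adjoint h h -> forall x, a (h x) = h (a x).
  move=> Mh hs; have hb : bounded_operator h by case: Mh.
  have [u uU uP] := cayley_unitary hb hs; apply/(uP a al) => y.
  rewrite aU//; split=> [|d Md]; first by case: uU.
  apply/funext => z /=; apply: (uP d (vn_linear Md)).1 => {}z.
  by rewrite (vn_commute Md Mh).
(* b is recovered from the self-adjoint elements b + b' and i (b - b') of M'. *)
have [b' bb' adj] := adjoint_ex (proj1 Mb).
have Mb' := commutant_adjoint Mb adj; have jda := adjointC adj.
have bl := commutant_linear Mb; have bl' := commutant_linear Mb'.
have h1 := sa (b \+ b') (commutantD Mb Mb').
have h2 := sa ('i%C \*: (b \+ ((-1) \*: b')))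
  (commutantZ _ (commutantD Mb (commutantZ _ Mb'))).
have {}h1 : a ((b \+ b') x) = (b \+ b') (a x).
  apply: h1; apply: adjoint_rdot => [|y z].
    by apply: commutant_linear; exact: commutantD.
  by rewrite /= rdotDl rdotDr (rdot_adjoint _ _ adj) (rdot_adjoint _ _ jda) addrC.
have {}h2 : a (('i%C \*: (b \+ ((-1) \*: b'))) x) =
    ('i%C \*: (b \+ ((-1) \*: b'))) (a x).
  apply: h2; apply: adjoint_rdot => [|y z].
    by apply: commutant_linear; apply/commutantZ/commutantD => //; exact: commutantZ.
  rewrite /= !scaleN1r !scalerBr !rdotE !rdot_iC (rdot_adjoint _ _ adj).
  by rewrite (rdot_adjoint _ _ jda) (linZ bl) (linZ bl'); ring.
have {}h2 : a (b x - b' x) = b (a x) - b' (a x).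
  move: h2; rewrite /= !scaleN1r (linZ al) => /(congr1 (fun v => 'i%C *: v)).
  by rewrite !scale_ii => /oppr_inj.
move: h1 h2; rewrite /= (linB al) (linD al) => h1 h2.
apply/esym/rdot_inj => z; have := rdot_congr h1 z.
by have := rdot_congr h2 z; rewrite !rdotE; lra.
Qed.

End VonNeumannAlgebra.

(** * Strong limits of sequences in M *)

Section Limits.
Variables (R : realType) (H : hilbertType R).
Implicit Types (u v : nat -> H) (l x y : H) (e : R).

Lemma eq_of_close (a b : R) : (forall e, 0 < e -> `|a - b| <= e) -> a = b.
Proof.
move=> ab; apply/eqP; rewrite -subr_eq0 -normr_eq0 eq_le normr_ge0 andbT.
by apply/ler_addgt0Pl => e e0; rewrite addr0 ab.
Qed.

Lemma le_of_close (a b : R) : (forall e, 0 < e -> a <= b + e) -> a <= b.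
Proof. by move=> ab; apply/ler_addgt0Pr => e /ab. Qed.

Lemma hcvg_unique u l m : hcvg u l -> hcvg u m -> l = m.
Proof.
move=> ul um; apply/subr0_eq/hnorm_small_eq0 => e e0.
have e2 : 0 < e / 2 by rewrite divr_gt0.
have [[N1 h1] [N2 h2]] := (ul _ e2, um _ e2).
rewrite (le_trans (hnorm_triangle (u (maxn N1 N2)) _ _))// hnormBC.
by rewrite (splitr e) lerD// ltW// ?h1 ?h2// ?leq_maxl ?leq_maxr.
Qed.

Lemma hcvg_lin (c : R[i]) u v l m :
  hcvg u l -> hcvg v m -> hcvg (fun n => c *: u n + v n) (c *: l + m).
Proof.
move=> ul vm e e0; have e2 : 0 < e / 2 by rewrite divr_gt0.
have c0 : 0 <= Normc.normc c by case: (c) => ? ?; exact: sqrtr_ge0.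
have c1 : 0 < Normc.normc c + 1 by rewrite ltr_wpDl.
have [[N1 h1] [N2 h2]] := (ul _ (divr_gt0 e2 c1), vm _ e2).
exists (maxn N1 N2) => n; rewrite geq_max => /andP[/h1 {}h1 /h2 {}h2].
rewrite opprD addrACA -scalerBr (le_lt_trans (hnorm_leD _ _))// hnormZ.
move: h1; rewrite ltr_pdivlMr//; have := hnorm_ge0 (u n - l).
set A := hnorm (u n - l); set C := Normc.normc c; rewrite -/C in c0.
by clearbody A C; nra.
Qed.

Lemma hcvg_map (a : H -> H) u l :
  bounded_operator a -> hcvg u l -> hcvg (a \o u) (a l).
Proof.
move=> /bounded_operatorP[al [C C0 aC]] ul e e0.
have C1 : 0 < C + 1 by rewrite ltr_wpDl.
have [N NP] := ul _ (divr_gt0 e0 C1).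
exists N => n /NP /=; rewrite ltr_pdivlMr// -(linB al) => h.
rewrite (le_lt_trans (aC _))//; have := hnorm_ge0 (u n - l); nra.
Qed.

Lemma hcvg_cst l : hcvg (fun=> l) l.
Proof. by move=> e e0; exists 0%N => n _; rewrite subrr hnorm0. Qed.

Lemma hcvg_hnorm_le u l (C : R) : hcvg u l -> (forall n, hnorm (u n) <= C) ->
  hnorm l <= C.
Proof.
move=> ul uC; apply: le_of_close => e e0; have [N NP] := ul e e0.
rewrite -[l](subrK (u N)) addrC (le_trans (hnorm_leD _ _))// lerD//.
by rewrite hnormBC ltW// NP.
Qed.

Lemma hcvg_rdot_le u l x (C : R) : hcvg u l -> (forall n, rdot (u n) x <= C) ->
  rdot l x <= C.
Proof.
move=> ul uC; apply: le_of_close => e e0; have [N NP] := hcvg_rdot x ul e0.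
have := NP N (leqnn N); rewrite ltr_norml => /andP[h _].
by have := uC N; lra.
Qed.

Lemma hcvg_rdot_ge u l x (C : R) (N0 : nat) : hcvg u l ->
  (forall n, (N0 <= n)%N -> C <= rdot (u n) x) -> C <= rdot l x.
Proof.
move=> ul uC; apply: le_of_close => e e0; have [N NP] := hcvg_rdot x ul e0.
have := NP _ (leq_maxl N N0); rewrite ltr_norml => /andP[_ h].
by have := uC _ (leq_maxr N N0); lra.
Qed.

(** Squared distances beyond N are at most 2 (u_N - inf u), which is small for a suitable N. Strong
    limits of monotone sequences of operators come from this, with u_n a quadratic form at a fixed
    vector. *)
Lemma hcvg_monotone (w : nat -> H) (u : nat -> R) :
  (forall n, 0 <= u n) -> (forall n m, (n <= m)%N -> u m <= u n) ->
  (forall N n m, (N <= n)%N -> (N <= m)%N -> exists2 k, (N <= k)%N &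
     rdot (w n - w m) (w n - w m) <= 2 * (u N - u k)) ->
  exists l, hcvg w l.
Proof.
move=> u0 ud wu; apply: hnorm_complete => e e0.
have uinf : has_inf (range u).
  by split; [exists (u 0%N), 0%N|exists 0 => _ [n _ <-]].
have e2 : 0 < e ^+ 2 / 2 by rewrite divr_gt0// exprn_gt0.
have [_ [N _ <-] hN] := inf_adherent e2 uinf.
exists N => n m Nn Nm; have [k _ h] := wu N n m Nn Nm.
have h2 : inf (range u) <= u k by apply: ge_inf; [case: uinf|exists k].
rewrite -(ltr_pXn2r (ltn0Sn 1)) ?nnegrE ?hnorm_ge0 ?ltW// -rdotxx.
by move: hN h h2; set I := inf _; clearbody I; lra.
Qed.

Variable M : set (H -> H).
Hypothesis HM : von_neumann_algebra M.

(** Linearity, contractivity, self-adjointness and commutation with M' all pass to pointwise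
    limits. *)
Lemma strong_limit (A : nat -> H -> H) :
  (forall n, M (A n)) -> (forall n, adjoint (A n) (A n)) ->
  (forall n x, hnorm (A n x) <= hnorm x) ->
  (forall x, exists l, hcvg (A^~ x) l) ->
  exists E, [/\ M E, adjoint E E & forall x, hcvg (A^~ x) (E x)].
Proof.
move=> MA As Ac /choice[E EP].
have El : linear E.
  move=> c x y; apply: hcvg_unique (EP _) _.
  rewrite (_ : A^~ _ = (fun n => c *: A n x + A n y)); first exact: hcvg_lin.
  by apply/funext => n; rewrite (vn_linear HM (MA n)).
exists E; split => //.
  apply/(vnP HM); split=> [|b Mb x].
    apply/bounded_operatorP; split=> //; exists 1 => // x; rewrite mul1r.
    by apply: hcvg_hnorm_le (EP x) _.
  apply: hcvg_unique (EP _); have := hcvg_map (proj1 Mb) (EP x).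
  rewrite (_ : b \o _ = A^~ (b x))//.
  by apply/funext => n /=; rewrite (vn_commute HM (MA n) Mb).
apply: adjoint_rdot => // x y; apply: eq_of_close => e e0.
have e2 : 0 < e / 2 by rewrite divr_gt0.
have [N1 h1] := hcvg_rdot y (EP x) e2; have [N2 h2] := hcvg_rdot x (EP y) e2.
have := h1 _ (leq_maxl N1 N2); have := h2 _ (leq_maxr N1 N2).
rewrite (rdot_adjoint _ _ (As _)) (rdotC y) !ltr_norml (rdotC x (E y)).
by move=> /andP[? ?] /andP[? ?]; rewrite ler_norml; apply/andP; split; lra.
Qed.

Lemma vn_iter (K : H -> H) n : M K -> M (iter n K).
Proof.
move=> MK; elim: n => [|n IH]; first exact: vn_id.
by rewrite (_ : iter n.+1 K = K \o iter n K); [exact: vn_comp|exact/funext].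
Qed.

Lemma rdot_iter (K : H -> H) n m x y : adjoint K K ->
  rdot (iter n K x) (iter m K y) = rdot (iter (n + m) K x) y.
Proof.
move=> Ks; elim: m n => [|m IH] n; first by rewrite addn0.
by rewrite /= -(rdot_adjoint _ _ Ks) -iterS IH addSnnS.
Qed.

(* E is the projection onto the fixed space of K^2. *)
Lemma even_powers_limit (K : H -> H) : M K -> adjoint K K ->
  (forall x, hnorm (K x) <= hnorm x) ->
  exists E, [/\ projection M E, forall x, hcvg (fun n => iter (n + n) K x) (E x),
    forall x, K (K (E x)) = E x & forall x, K x = x -> E x = x].
Proof.
move=> MK Ks Kc.
have itc n x : hnorm (iter n K x) <= hnorm x.
  by elim: n => //= n; exact: le_trans.
have ud x n m : (n <= m)%N -> rdot (iter m K x) (iter m K x) <=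
    rdot (iter n K x) (iter n K x).
  by move=> /subnK <-; rewrite iterD; apply: hnorm_sq_le; exact: itc.
have [||||E [ME Es EP]] := @strong_limit (fun n => iter (n + n) K).
- by move=> n; exact: vn_iter.
- move=> n; apply: adjoint_rdot => [|x y]; first exact/(vn_linear HM)/vn_iter.
  by rewrite -[y in LHS]/(iter 0 K y) -[x in RHS]/(iter 0 K x) !rdot_iter// addn0.
- by move=> n x; exact: itc.
- move=> x; apply: (@hcvg_monotone _ (fun n => rdot (iter n K x) (iter n K x))).
  + by move=> n; exact: rdotxx_ge0.
  + by move=> n m; exact: ud.
  (* With u_j = |K^j x|^2, which decreases, |K^(2n) x - K^(2m) x|^2 = u_(2n) + u_(2m) - 2 u_(n+m).
     Even powers are what makes the cross term a square. *)
  move=> N n m Nn Nm; exists (n + m)%N; first by rewrite (leq_trans Nn)// leq_addr.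
  have h1 := ud x N (n + n)%N (leq_trans Nn (leq_addr _ _)).
  have h2 := ud x N (m + m)%N (leq_trans Nm (leq_addr _ _)).
  rewrite !rdotE (rdotC (iter (m + m) K x)) (rdot_iter (n + n) (m + m))//.
  rewrite addnACA -(rdot_iter (n + m) (n + m))//.
  by lra.
have KKE x : K (K (E x)) = E x.
  apply/esym/(hcvg_unique (EP x)).
  have := hcvg_map (vn_bounded HM (vn_comp HM MK MK)) (EP x).
  move=> h e e0; have [N NP] := h e e0; exists N.+1 => -[//|n] Nn.
  by have := NP n Nn; rewrite /= addnS /=.
have KE x : K (K x) = x -> E x = x.
  move=> Kx; apply: hcvg_unique (EP x) _.
  rewrite (_ : (fun n => _) = fun=> x); first exact: hcvg_cst.
  by apply/funext => n; elim: n => //= n; rewrite addnS /= => ->.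
exists E; split => // [|x Kx]; last by apply: KE; rewrite !Kx.
by split => //; apply/funext => x /=; rewrite KE.
Qed.

End Limits.

(** * Trace inequalities for supports and meets of projections *)

Section Trace.
Variables (R : realType) (H : hilbertType R) (M : set (H -> H)).
Hypothesis HM : von_neumann_algebra M.
Variable tau : (H -> H) -> \bar R.
Hypothesis Htau : fns_trace M tau.
Implicit Types (a b p q g e f T : H -> H) (x y : H).

Lemma im_selfadjoint a x : adjoint a a -> rdot (a x) ('i%C *: x) = 0.
Proof.
move=> aa; have := hdotC (a x) x; rewrite aa => /(congr1 (@complex.Im R)).
rewrite !hdot_rdot /= => h; have := rdot_iC (a x) x; rewrite rdotC.
by lra.
Qed.

Lemma positive_rdot a : M a -> adjoint a a -> (forall x, 0 <= rdot (a x) x) ->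
  positive_part M a.
Proof.
move=> Ma aa a0; split=> // x; rewrite hdot_rdot im_selfadjoint//.
by rewrite lecE /= eqxx a0.
Qed.

Lemma positive_sq a b : M a -> adjoint a b -> positive_part M (b \o a).
Proof.
move=> Ma ab; have ba := adjointC ab; apply: positive_rdot.
- by apply: (vn_comp HM) => //; exact: (vn_adjoint_in HM) ab.
- exact: adjoint_comp.
- by move=> x /=; rewrite (rdot_adjoint _ _ ba) rdotxx_ge0.
Qed.

Lemma positive_im a x : positive_part M a -> rdot (a x) ('i%C *: x) = 0.
Proof.
by case=> _ /(_ x); rewrite hdot_rdot lecE /= => /andP[/eqP].
Qed.

Lemma op_le_rdot a b : positive_part M a -> positive_part M b ->
  op_le a b <-> forall x, rdot (a x) x <= rdot (b x) x.
Proof.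
move=> pa pb; split=> ab x; have := ab x.
  by rewrite hdot_rdot lecE /= => /andP[_]; rewrite rdotBl subr_ge0.
rewrite hdot_rdot lecE /= !rdotBl positive_im// positive_im// subr0 eqxx.
by rewrite subr_ge0.
Qed.

Lemma trace_le a b : positive_part M a -> positive_part M b ->
  (forall x, rdot (a x) x <= rdot (b x) x) -> (tau a <= tau b)%E.
Proof.
move=> pa pb ab; have pba : positive_part M (b \- a).
  split; first by apply: (vnB HM); [case: pb|case: pa].
  exact: (op_le_rdot pa pb).2.
have -> : b = a \+ (b \- a) by apply/funext => x /=; rewrite addrC subrK.
by rewrite (traceD Htau)// leeDl// (trace_ge0 Htau).
Qed.

Lemma trace0 : tau (id \- id) = 0%E.
Proof.
(* The trace of the identity may be infinite; homogeneity at 0 still gives 0, since 0 times +oo is 0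
   in [\bar R]. *)
have -> : id \- id = (0 : R)%:C \*: (id : H -> H).
  by apply/funext => x /=; rewrite subrr scale0r.
rewrite (traceZ Htau)// ?mul0e//; apply: positive_rdot => //=.
  exact: vn_id.
by move=> x; exact: rdotxx_ge0.
Qed.

Lemma projection_pos p : projection M p -> positive_part M p.
Proof.
move=> [Mp pE pp]; rewrite -[X in positive_part M X]pE.
exact: positive_sq.
Qed.

Lemma proj_idem p x : projection M p -> p (p x) = p x.
Proof. by move=> [_ /(congr1 (@^~ x))]. Qed.

Lemma proj_rdot p x y : projection M p -> rdot (p x) y = rdot x (p y).
Proof. by move=> [_ _ pp]; exact: rdot_adjoint. Qed.

Lemma proj_sq p x : projection M p -> rdot (p x) (p x) = rdot (p x) x.
Proof. by move=> pp; rewrite !(proj_rdot _ _ pp) proj_idem. Qed.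

Lemma proj_hnorm p x : projection M p -> hnorm (p x) <= hnorm x.
Proof.
move=> pp; have := proj_sq x pp; have := rdot_le (p x) x; rewrite rdotxx.
by have := hnorm_ge0 (p x); have := hnorm_ge0 x; nra.
Qed.

Lemma proj_linear p : projection M p -> linear p.
Proof. by case=> /(vn_linear HM). Qed.

Lemma projectionI p : M p -> (forall x, p (p x) = p x) ->
  (forall x y, rdot (p x) y = rdot x (p y)) -> projection M p.
Proof.
move=> Mp pp pa; split=> //; first exact/funext.
by apply: adjoint_rdot => //; exact: (vn_linear HM).
Qed.

Lemma proj_compl p : projection M p -> projection M (id \- p).
Proof.
move=> pp; have pl := proj_linear pp; apply: projectionI.
- by apply: (vnB HM); [exact: vn_id|case: pp].
- by move=> x /=; rewrite (linB pl) proj_idem// subrr subr0.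
- by move=> x y /=; rewrite rdotBl rdotBr proj_rdot.
Qed.

(* l is the left support of T; the factor 2 stands in for the equality of the
   traces of the left and right supports. With K = 1 - TT^* and J = 1 - T^*T,
   1 - K^(2n) increases to l, and the bound on its trace is telescoped from
   tau (K^n T T^* K^n) = tau (T^* K^n K^n T), where K^n T = T J^n. *)
Lemma left_support T T' g : M T -> adjoint T T' ->
  (forall x, hnorm (T x) <= hnorm x) ->
  projection M g -> (forall x, T (g x) = T x) ->
  exists l, [/\ projection M l, forall x, l (T x) = T x,
    forall x, T' x = 0 -> l x = 0 & (tau l <= tau g + tau g)%E].
Proof.
move=> MT TT' Tc pg Tg; have T'T := adjointC TT'.
have MT' := vn_adjoint_in HM MT TT'.
have Tl := vn_linear HM MT; have T'l := vn_linear HM MT'.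
have T'c x : hnorm (T' x) <= hnorm x.
  have := rdotxx (T' x); rewrite (rdot_adjoint _ _ T'T) => h.
  have := rdot_le x (T (T' x)); rewrite h.
  have := Tc (T' x); have := hnorm_ge0 (T' x); have := hnorm_ge0 x.
  have := hnorm_ge0 (T (T' x)).
  by nra.
pose K : H -> H := id \- (T \o T'); pose J : H -> H := id \- (T' \o T).
have MK : M K by apply: (vnB HM); [exact: vn_id|exact: (vn_comp HM)].
have MJ : M J by apply: (vnB HM); [exact: vn_id|exact: (vn_comp HM)].
have Kl := vn_linear HM MK; have Jl := vn_linear HM MJ.
have Ks : adjoint K K.
  apply: adjoint_rdot => // x y; rewrite /K /= rdotBl rdotBr.
  by rewrite (rdot_adjoint _ _ TT') -(rdot_adjoint _ _ TT') (rdot_adjoint _ _ TT')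
    (rdot_adjoint _ _ T'T).
have Js : adjoint J J.
  apply: adjoint_rdot => // x y; rewrite /J /= rdotBl rdotBr.
  by rewrite (rdot_adjoint _ _ T'T) (rdot_adjoint _ _ TT').
have Ksq x : rdot (K x) (K x) =
    rdot x x - 2 * rdot (T' x) (T' x) + rdot (T (T' x)) (T (T' x)).
  rewrite /K /= !rdotE (rdotC x (T _)) (rdot_adjoint _ _ TT').
  by ring.
have Jsq x : rdot (J x) (J x) =
    rdot x x - 2 * rdot (T x) (T x) + rdot (T' (T x)) (T' (T x)).
  rewrite /J /= !rdotE (rdotC x (T' _)) (rdot_adjoint _ _ T'T).
  by ring.
have Kle x : rdot (K x) (K x) <= rdot x x - rdot (T' x) (T' x).
  by rewrite Ksq; have := hnorm_sq_le (Tc (T' x)); lra.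
have Jle x : rdot (J x) (J x) <= rdot x x - rdot (T x) (T x).
  by rewrite Jsq; have := hnorm_sq_le (T'c (T x)); lra.
have Kc x : hnorm (K x) <= hnorm x.
  by apply: hnorm_le_sq; have := Kle x; have := rdotxx_ge0 (T' x); lra.
have KT n x : iter n K (T x) = T (iter n J x).
  elim: n => //= n ->; rewrite /K /J /= (linB Tl).
  by [].
have [E [pE EP KKE KE]] := even_powers_limit HM MK Ks Kc.
have El := proj_linear pE.
(* K K E = E and K contracts, so |K E x| = |E x|; as |K y|^2 <= |y|^2 - |T' y|^2, this forces T' E x
   = 0. *)
have T'E x : T' (E x) = 0.
  apply/hnorm_eq0/eqP; rewrite -sqrf_eq0 -rdotxx eq_le rdotxx_ge0 andbT.
  have := Kle (E x); have := hnorm_sq_le (Kc (K (E x))).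
  by rewrite KKE; lra.
have ET x : E (T x) = 0.
  apply: rdot_inj => y; rewrite proj_rdot// (rdot_adjoint _ _ TT') T'E.
  by rewrite rdot0l rdot0r.
pose A n : H -> H := id \- iter (n + n) K.
have Aq n x : rdot (A n x) x = rdot x x - rdot (iter n K x) (iter n K x).
  by rewrite /A /= rdotBl rdot_iter.
have ud x n m : (n <= m)%N -> rdot (iter m K x) (iter m K x) <=
    rdot (iter n K x) (iter n K x).
  move=> /subnK <-; rewrite iterD; apply: hnorm_sq_le.
  by elim: (m - n)%N => //= k; exact: le_trans.
have pA n : positive_part M (A n).
  apply: positive_rdot => [||x].
  - by apply: (vnB HM); [exact: vn_id|exact: vn_iter].
  - apply: adjoint_rdot => [|x y].
      by apply/(vn_linear HM)/(vnB HM); [exact: vn_id|exact: vn_iter].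
    rewrite /A /= rdotBl rdotBr; congr (_ - _).
    by rewrite -[y in LHS]/(iter 0 K y) -[x in RHS]/(iter 0 K x) !rdot_iter// addn0.
  - by rewrite Aq subr_ge0; exact: (ud x 0%N n).
pose l : H -> H := id \- E.
have pl : projection M l by exact: proj_compl.
have lq x : rdot (l x) x = rdot x x - rdot (E x) x by rewrite /l /= rdotBl.
exists l; split => //.
- by move=> x; rewrite /l /= ET subr0.
- by move=> x T'x; rewrite /l /= KE ?subrr// /K /= T'x lin0// subr0.
(* By normality it is enough to bound tau (A_n) for each n, l being the least upper bound of this
   increasing sequence. *)
rewrite (@trace_normal _ _ _ _ Htau [set A n | n in setT] l); first last.
- split; first exact: projection_pos.
    move=> _ [n _ <-]; apply/op_le_rdot => // [|x]; first exact: projection_pos.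
    rewrite Aq lq lerB//; apply: (@hcvg_rdot_le _ _ (fun k => iter (k + n + (k + n)) K x)).
      move=> d d0; have [N NP] := EP x d d0; exists N => k Nk.
      by apply: NP; rewrite (leq_trans Nk)// leq_addr.
    by move=> k; rewrite -rdot_iter//; apply: ud; exact: leq_addl.
  move=> c pc cA; apply/op_le_rdot => // [|x]; first exact: projection_pos.
  rewrite lq lerBlDr -lerBlDl; apply: (@hcvg_rdot_ge _ _ _ _ _ _ 0%N (EP x)) => n _.
  have := (op_le_rdot (pA n) pc).1 (cA _ (ex_intro2 _ _ n I erefl)) x.
  by rewrite Aq -rdot_iter//; lra.
- split; first by exists (A 0%N), 0%N.
  move=> _ _ [n _ <-] [m _ <-]; exists (A (maxn n m)); split.
  + by exists (maxn n m).
  + apply/op_le_rdot => // x; rewrite !Aq lerB//; apply: ud; exact: leq_maxl.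
  + apply/op_le_rdot => // x; rewrite !Aq lerB//; apply: ud; exact: leq_maxr.
- by move=> _ [n _ <-].
apply: ge_ereal_sup => _ [_ [n _ <-] <-].
(* G_n = g J^(2n) g is the part of g left after n steps. A_(n+1) <= A_n + 2 B_n from expanding |K
   y|^2, tau B_n = tau C_n by the trace property, and G_(n+1) + C_n <= G_n from |J y|^2 <= |y|^2 -
   |T y|^2 and T g = T. *)
pose G n : H -> H := (g \o iter n J) \o (iter n J \o g).
pose B n : H -> H := (iter n K \o T) \o (T' \o iter n K).
pose C n : H -> H := (T' \o iter n K) \o (iter n K \o T).
have iters L n' : adjoint L L -> adjoint (iter n' L) (iter n' L).
  move=> Ls; elim: n' => // k IH x y /=.
  by rewrite Ls IH -iterSr.
have Gs n' : adjoint (iter n' J \o g) (g \o iter n' J).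
  by apply: adjoint_comp; [exact: iters|case: pg].
have Bs n' : adjoint (T' \o iter n' K) (iter n' K \o T).
  by apply: adjoint_comp => //; exact: iters.
have pG n' : positive_part M (G n').
  apply: positive_sq => //; apply: (vn_comp HM); first exact: vn_iter.
  by case: pg.
have MB n' : M (T' \o iter n' K) by apply: (vn_comp HM) => //; exact: vn_iter.
have pB n' : positive_part M (B n') by exact: positive_sq.
have pC n' : positive_part M (C n').
  apply: positive_sq; last exact/adjointC.
  by apply: (vn_comp HM) => //; exact: vn_iter.
have posD a b : positive_part M a -> positive_part M b -> positive_part M (a \+ b).
  move=> [Ma a0] [Mb b0]; split=> [|x]; first exact: vnD.
  by rewrite /= hdotDl addr_ge0.
have GC k : (tau (G k.+1) + tau (C k) <= tau (G k))%E.
  rewrite -(traceD Htau)//; apply: trace_le => // [|x]; first exact: posD.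
  have GE n' : rdot (G n' x) x = rdot (iter n' J (g x)) (iter n' J (g x)).
    by rewrite /G /= (proj_rdot _ _ pg) (rdot_adjoint _ _ (iters _ _ J n' Js)).
  have -> : rdot ((G k.+1 \+ C k) x) x = rdot (G k.+1 x) x +
      rdot (T (iter k J (g x))) (T (iter k J (g x))).
    rewrite /= rdotDl; congr (_ + _); rewrite -KT Tg /C /=.
    by rewrite (rdot_adjoint _ _ T'T) (rdot_adjoint _ _ (iters _ _ K k Ks)).
  by rewrite !GE /=; have := Jle (iter k J (g x)); lra.
have AB k : (tau (A k.+1) <= tau (A k) + (tau (B k) + tau (B k)))%E.
  rewrite -!(traceD Htau)//; last exact: posD.
  apply: trace_le => // [|x]; first exact: posD (pA k) (posD _ _ (pB k) (pB k)).
  rewrite [rdot ((A k \+ _) x) x]rdotDl [rdot ((B k \+ _) x) x]rdotDl !Aq.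
  have -> : rdot (B k x) x = rdot (T' (iter k K x)) (T' (iter k K x)).
    by rewrite /B /= (rdot_adjoint _ _ (iters _ _ K k Ks)) (rdot_adjoint _ _ TT').
  by rewrite /= Ksq; have := rdotxx_ge0 (T (T' (iter k K x))); lra.
have BC k : tau (B k) = tau (C k).
  by rewrite /B /C (trace_comm Htau (MB k) (Bs k)).
(* The quantity tau A_n + 2 tau G_n does not increase with n and starts at 2 tau g, as A_0 = 0 and
   G_0 = g. In this form no subtraction of possibly infinite traces occurs. *)
have key : (tau (A n) + (tau (G n) + tau (G n)) <= tau g + tau g)%E.
  elim: n => [|k IH].
    have -> : G 0%N = g by apply/funext => x; rewrite /G /= proj_idem.
    by rewrite trace0 add0e.
  apply: le_trans IH; apply: (@le_trans _ _
    (tau (A k) + (tau (B k) + tau (B k)) + (tau (G k.+1) + tau (G k.+1)))%E).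
    by rewrite leeD2r.
  rewrite -addeA leeD2l// addeC addeACA BC.
  by apply: leeD; exact: GC.
by apply: le_trans key; rewrite leeDl// adde_ge0// (trace_ge0 Htau).
Qed.

Definition is_meet p q e : Prop :=
  [/\ projection M e, forall x, p (e x) = e x, forall x, q (e x) = e x &
      forall x, p x = x -> q x = x -> e x = x].

(** e = p - l, with l the left support of T = p (1 - q). A vector in the range of p is orthogonal to
    the range of T exactly when (1 - q) p kills it, that is when it lies in the range of q. *)
Lemma meet_ex p q : projection M p -> projection M q ->
  exists2 e, is_meet p q e & (tau (id \- e)%R <=
    tau (id \- p)%R + (tau (id \- q)%R + tau (id \- q)%R))%E.
Proof.
move=> pp pq; have pg := proj_compl pq; set g := id \- q in pg *.
have Mp : M p by case: pp.
have Mg : M g by case: pg.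
have TT' : adjoint (p \o g) (g \o p).
  by apply: adjoint_comp; [case: pp|case: pg].
have pl := proj_linear pp.
have [|||||l [prl lT l0 tl]] := @left_support (p \o g) (g \o p) g.
- exact: vn_comp.
- by [].
- by move=> x /=; rewrite (le_trans (proj_hnorm _ pp))// proj_hnorm.
- by [].
- by move=> x /=; rewrite proj_idem.
have ll := proj_linear prl.
have lp x : l (p x) = l x.
  apply/esym/subr0_eq; rewrite -(linB ll); apply: l0 => /=.
  by rewrite (linB pl) proj_idem// subrr (lin0 (proj_linear pg)).
have pl' x : p (l x) = l x.
  apply: rdot_inj => y; rewrite (proj_rdot _ _ pp) !(proj_rdot _ _ prl).
  by rewrite lp.
have eg x : p (g x) - l (g x) = 0 by rewrite -(lp (g x)) lT subrr.
have ea x y : rdot (p x - l x) y = rdot x (p y - l y).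
  by rewrite rdotBl rdotBr (proj_rdot _ _ pp) (proj_rdot _ _ prl).
exists (p \- l).
  split.
  - apply: projectionI => //; first by apply: (vnB HM) => //; case: prl.
    move=> x /=; rewrite (linB pl) (linB ll) !proj_idem// pl' lp subrr subr0.
    by [].
  - by move=> x /=; rewrite (linB pl) proj_idem// pl'.
  - move=> x /=; apply/esym/subr0_eq; rewrite -[LHS]/(g _).
    apply: rdot_inj => y; rewrite (proj_rdot _ _ pg) ea eg.
    by rewrite rdot0r rdot0l.
  - move=> x px qx /=; rewrite px l0 ?subr0//= px /g /= qx subrr.
    by [].
have -> : id \- (p \- l) = (id \- p) \+ l.
  by apply/funext => x /=; rewrite opprB addrA addrAC.
rewrite (traceD Htau) ?leeD2l//; first exact/projection_pos/proj_compl.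
exact: projection_pos.
Qed.

Lemma projection_le p q x : projection M p -> projection M q ->
  (forall x, q (p x) = p x) -> rdot (p x) x <= rdot (q x) x.
Proof.
move=> pp pq qp; rewrite -!proj_sq//; apply: hnorm_sq_le.
have := rdotxx (p x); rewrite proj_sq// -qp (proj_rdot _ _ pq) => h.
have := rdot_le (p x) (q x); rewrite h.
have := hnorm_ge0 (p x); have := hnorm_ge0 (q x); rewrite qp.
by nra.
Qed.

(** The successive meets e_n of r_0, ..., r_n decrease and fix w, so their strong limit E fixes w
    too. As 0 <= E <= r_n for all n, tau E = 0, and faithfulness gives E = 0. *)
Lemma small_projections_fix0 (r : nat -> H -> H) w :
  (forall n, projection M (r n)) -> (forall n, r n w = w) ->
  (forall d : R, 0 < d -> exists n, (tau (r n) <= d%:E)%E) -> w = 0.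
Proof.
move=> pr rw tr.
(* The meet is made a total function, with the dummy value [id] off projections, so that e can be
   defined by recursion. *)
have [mt mtP] : exists mt : (H -> H) * (H -> H) -> (H -> H), forall pq,
    projection M pq.1 -> projection M pq.2 -> is_meet pq.1 pq.2 (mt pq).
  suff /choice : forall pq : (H -> H) * (H -> H), exists e : H -> H,
      projection M pq.1 -> projection M pq.2 -> is_meet pq.1 pq.2 e.
    by move=> [mt mtP]; exists mt.
  move=> [p q] /=.
  have [pp|np] := pselect (projection M p); last by exists id.
  have [pq|nq] := pselect (projection M q); last by exists id.
  by have [e ePQ _] := meet_ex pp pq; exists e.
pose e := fix e n := if n is n'.+1 then mt (e n', r n) else r 0%N.
have pe n : projection M (e n).
  by elim: n => [|n IH]; [exact: pr|have [] := mtP (e n, r n.+1) IH (pr _)].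
have eS n : is_meet (e n) (r n.+1) (e n.+1) by exact: (mtP (e n, r n.+1) (pe n) (pr n.+1)).
have ew n : e n w = w.
  by elim: n => [|n IH]; [exact: rw|have [_ _ _] := eS n; apply].
have er n x : r n (e n x) = e n x.
  by case: n => [|n]; [exact: proj_idem|have [] := eS n].
have ee n m x : (n <= m)%N -> e n (e m x) = e m x.
  move=> /subnK <-; elim: (m - n)%N x => [|k IH] x; first exact: proj_idem.
  by have [_ h _ _] := eS (k + n)%N; rewrite addSn -h IH.
have edec n m x : (n <= m)%N -> rdot (e m x) x <= rdot (e n x) x.
  by move=> nm; apply: projection_le => // y; exact: ee.
have [||||E [ME Es EP]] := @strong_limit _ _ _ HM e.
- by move=> n; case: (pe n).
- by move=> n; case: (pe n).
- by move=> n x; exact: proj_hnorm.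
- move=> x; apply: (@hcvg_monotone _ _ _ (fun n => rdot (e n x) x)).
  + by move=> n; rewrite -proj_sq// rdotxx_ge0.
  + by move=> n m; exact: edec.
  have aux N n m : (N <= n)%N -> (n <= m)%N ->
      rdot (e n x - e m x) (e n x - e m x) <= 2 * (rdot (e N x) x - rdot (e m x) x).
    move=> Nn nm; have nmx : rdot (e n x) (e m x) = rdot (e m x) x.
      by rewrite (proj_rdot _ _ (pe n)) ee// rdotC.
    rewrite !rdotE !proj_sq// (rdotC (e m x)) nmx; have := edec _ _ x Nn; have := edec _ _ x nm.
    by lra.
  move=> N n m Nn Nm; case: (leqP n m) => nm; first by exists m => //; exact: aux.
  exists n => //; rewrite -opprB rdotNl rdotNr opprK; exact/aux/ltnW.
have E0 x : 0 <= rdot (E x) x.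
  by apply: (hcvg_rdot_ge (N0 := 0) (EP x)) => n _; rewrite -proj_sq// rdotxx_ge0.
have pE : positive_part M E by exact: positive_rdot.
have Er n x : rdot (E x) x <= rdot (r n x) x.
  apply: (le_trans _ (projection_le x (pe n) (pr n) (er n))).
  apply: (@hcvg_rdot_le _ _ (fun k => e (k + n)%N x)).
    move=> d d0; have [N NP] := EP x d d0; exists N => k Nk.
    by apply: NP; rewrite (leq_trans Nk)// leq_addr.
  by move=> k; apply: edec; exact: leq_addl.
have tE : tau E = 0%E.
  apply/eqP; rewrite eq_le (trace_ge0 Htau)// andbT.
  apply/lee_addgt0Pr => d d0; rewrite add0e; have [n tn] := tr d d0.
  apply: le_trans tn; apply: trace_le => //; exact: projection_pos.
rewrite -(trace_faithful Htau pE tE w).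
apply: hcvg_unique (EP w); rewrite (_ : e^~ w = fun=> w); first exact: hcvg_cst.
exact/funext.
Qed.

End Trace.

(** * Closability and measurability of sums and scalar multiples *)

Section Measurable.
Variables (R : realType) (H : hilbertType R) (M : set (H -> H)).
Hypothesis HM : von_neumann_algebra M.
Variable tau : (H -> H) -> \bar R.
Hypothesis Htau : fns_trace M tau.
Implicit Types (p q g e f T u : H -> H) (x y v : H) (X Y A G : set (H * H)).
Implicit Types (c : R[i]).

Lemma dot2Zl c (z w : H * H) : dot2 (c *: z) w = dot2 z (Num.conj c *: w).
Proof.
rewrite /dot2 /rdot /= !hdotZl !hdotZr; congr (_ + _).
all: by case: (c) => a b; case: (hdot H _ _) => a' b' /=; ring.
Qed.

Lemma dot2Dl (z z' w : H * H) : dot2 (z + z') w = dot2 z w + dot2 z' w.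
Proof. by rewrite /dot2 /= !rdotDl addrACA. Qed.

Lemma dot2Nl (z w : H * H) : dot2 (- z) w = - dot2 z w.
Proof. by rewrite /dot2 /= !rdotNl opprD. Qed.

Lemma dot2_sub (z w : H * H) :
  dot2 (z - w) (z - w) = dot2 z z - 2 * dot2 z w + dot2 w w.
Proof. by rewrite /dot2 /= !rdotE (rdotC w.1 z.1) (rdotC w.2 z.2); ring. Qed.

Lemma dot2xx_eq0 (z : H * H) : dot2 z z = 0 -> z = 0.
Proof.
case: z => x y; rewrite /dot2 /= => xy.
have x0 := rdotxx_ge0 x; have y0 := rdotxx_ge0 y.
by congr (_, _); apply: rdotxx_eq0; lra.
Qed.

Lemma subspaceZD G c (z w : H * H) : closed_subspace G ->
  G z -> G w -> G (c *: z + w).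
Proof. by case: z w => [x y] [x' y'] Gs; exact: subspace_lin. Qed.

Lemma subspaceZ G c (z : H * H) : closed_subspace G -> G z -> G (c *: z).
Proof.
move=> Gs Gz; rewrite -[c *: z]addr0; apply: subspaceZD => //.
exact: subspace0 Gs.
Qed.

Lemma subspaceB G (z w : H * H) : closed_subspace G -> G z -> G w -> G (z - w).
Proof.
by move=> Gs Gz Gw; rewrite addrC -scaleN1r; exact: subspaceZD.
Qed.

Lemma projection_unique G (z w : H * H) : closed_subspace G -> G z -> G w ->
  (forall t, G t -> dot2 z t = dot2 w t) -> z = w.
Proof.
move=> Gs Gz Gw zw; apply/subr0_eq/dot2xx_eq0.
by rewrite dot2Dl dot2Nl zw ?subrr//; exact: subspaceB.
Qed.

Lemma closed_operator_subspace X : closed_operator X -> closed_subspace X.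
Proof. by case=> X0 Xl _ Xc _; split. Qed.

(* T v is the second coordinate of the projection of (v, 0) onto the graph of
   the restriction of X to ker p; the left support of T carries the range of
   that restriction. *)
Lemma range_support X p : closed_operator X -> affiliated M X ->
  projection M p -> exists r, [/\ projection M r,
    (tau (id \- r)%R <= tau (id \- p)%R + tau (id \- p)%R)%E &
    forall x y, X (x, y) -> p x = 0 -> r y = 0].
Proof.
move=> Xc Xa pp; have Xs := closed_operator_subspace Xc.
have pl := proj_linear HM pp.
pose G : set (H * H) := [set z | X z /\ p z.1 = 0].
have Gs : closed_subspace G.
  split=> [|c x y x' y' [/= Xx px] [/= Xx' px']|].
  - by split; [exact: subspace0|rewrite /= (lin0 pl)].
  - by split; [exact: (subspace_lin Xs)|rewrite /= pl px px' scaler0 addr0].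
  case=> x y cl; split.
    apply: (subspace_closed Xs); apply: closureS cl => z; by case.
  apply: hnorm_small_eq0 => d d0; have /closure_hnorm /(_ d d0) := cl.
  move=> [x' [y' [[/= _ px'] xx' _]]].
  rewrite -(subr0 (p x)) -px' -(linB pl) (le_trans (proj_hnorm _ pp))//.
  by rewrite hnormBC ltW.
have [P PP] := projection_ex Gs.
have PG z : G (P z) by have [] := PP z.
have Pd z w : G w -> dot2 z w = dot2 (P z) w by have [_] := PP z; apply.
have Pl c z w : P (c *: z + w) = c *: P z + P w.
  apply: (projection_unique Gs) => // [|t Gt]; first exact: subspaceZD.
  rewrite -Pd// !dot2Dl !dot2Zl (Pd z) ?(Pd w)//.
  exact: subspaceZ.
have Pc z : dot2 (P z) (P z) <= dot2 z z.
  have : 0 <= dot2 (z - P z) (z - P z) by rewrite addr_ge0 ?rdotxx_ge0.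
  by rewrite dot2_sub (Pd z (P z))//; lra.
pose T v := (P (v, 0)).2.
have Tl : linear T.
  move=> c x y; rewrite /T -[RHS]/((c *: P (x, 0) + P (y, 0)).2) -Pl.
  by congr (P (_, _)).2; rewrite /= scaler0 addr0.
have Tc x : hnorm (T x) <= hnorm x.
  apply: hnorm_le_sq; have := Pc (x, 0); rewrite /dot2 /= rdot0l addr0.
  by have := rdotxx_ge0 (P (x, 0)).1; rewrite /T; lra.
have Tb : bounded_operator T.
  by apply/bounded_operatorP; split=> //; exists 1 => // x; rewrite mul1r.
(* For a unitary u of M', the subspace G is invariant under u + u acting coordinatewise, in both
   directions, because X is affiliated and p is in M. So the projection onto G commutes with this
   action, and T commutes with u. *)
have MT : M T.
  apply: (vn_of_unitaries HM) => // u Mu uU x.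
  have [uu [v [uv [uK vK]]]] := unitaryP uU.
  have ul := commutant_linear Mu.
  have uG z : G z <-> G (u z.1, u z.2).
    case: z => z1 z2; rewrite /G /=.
    have pu : p (u z1) = u (p z1) by case: pp => Mp _ _; rewrite (vn_commute HM Mp Mu).
    split=> -[Xz pz]; split.
    - exact: (Xa u Mu uU _ _).1.
    - by rewrite pu pz (lin0 ul).
    - exact: (Xa u Mu uU _ _).2.
    - by rewrite -(vK (p z1)) -pu pz (lin0 (adjoint_linear uv)).
  rewrite /T; have -> : P (u x, 0) = (u (P (x, 0)).1, u (P (x, 0)).2); last by [].
  apply: (projection_unique Gs) => // [|t Gt]; first exact: (uG (P (x, 0))).1.
  rewrite -Pd//.
  have tE : t = (u (v t.1), u (v t.2)) by rewrite !uK -surjective_pairing.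
  have Gv : G (v t.1, v t.2) by apply: (uG _).2; rewrite /= !uK -surjective_pairing.
  have := Pd (x, 0) _ Gv; rewrite /dot2 /= rdot0l => h.
  by rewrite tE /= !uu rdot0l.
have [T' MT' TT'] := vn_adjoint HM MT.
(* (p x, 0) is orthogonal to G, whence T (1 - p) = T and the support bound holds with g = 1 - p. *)
have [] := left_support HM Htau MT TT' Tc (proj_compl HM pp).
  move=> x; rewrite /T; congr (_.2).
  apply: (projection_unique Gs) => // t Gt; rewrite -!Pd// /dot2 /= !rdot0l !addr0.
  by rewrite rdotBl (proj_rdot _ _ pp); case: Gt => _ ->; rewrite rdot0r subr0.
move=> l [pl' lT l0 tl]; exists (id \- l); split; first exact: proj_compl.
  rewrite (_ : id \- (id \- l) = l)//.
  by apply/funext => x /=; rewrite opprB addrC subrK.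
move=> x y Xxy px; have Gxy : G (x, y) by [].
(* The projection (s, t) of (0, w) onto G vanishes: <s, v> = <w, T v> = 0 for all v, because l w = 0
   and l T = T, and then t is the value of X at 0. So (0, w) is orthogonal to (x, y), and <(1 - l)
   y, y> = 0. *)
set w := (id \- l) y; case Pw : (P (0, w)) => [s t].
have Gst : G (s, t) by rewrite -Pw.
have lw : l w = 0 by rewrite /w /= (linB (proj_linear HM pl')) (proj_idem _ pl') subrr.
have s0 : s = 0.
  apply: rdot_inj => v; rewrite rdot0l.
  have := Pd (v, 0) _ Gst; rewrite /dot2 /= rdot0l addr0 rdotC => ->.
  have := Pd (0, w) _ (PG (v, 0)); rewrite Pw /dot2 /= rdot0l add0r => h.
  rewrite (rdotC _ s) (rdotC _ t) -h.
  by rewrite -[(P _).2]/(T v) -lT -(proj_rdot _ _ pl') lw rdot0l.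
have t0 : t = 0.
  case: Gst => /= Xst _; rewrite s0 in Xst.
  exact: (graph_functional Xc Xst (graph0 Xc)).
have := Pd (0, w) _ Gxy; rewrite Pw s0 t0 /dot2 /= !rdot0l !add0r => wy.
by apply: rdotxx_eq0; rewrite (proj_sq _ (proj_compl HM pl')).
Qed.

(** X p is closed and everywhere defined, so the closed graph theorem applies. *)
Lemma restriction_bounded X p : closed_operator X -> projection M p ->
  (forall x, op_domain X (p x)) -> exists2 C : R, 0 <= C &
  forall x, exists2 y, X (p x, y) & hnorm y <= C * hnorm x.
Proof.
move=> Xc pp /choice[T XT]; have pl := proj_linear HM pp.
have Tl : linear T.
  move=> c x y; apply: (graph_functional Xc (XT _)).
  by rewrite pl; exact: (graph_linear Xc).
have /bounded_operatorP[_ [C C0 TC]] : bounded_operator T.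
  apply: closed_graph_theorem => //; case=> x y /closure_hnorm cl /=.
  apply: (graph_functional Xc _ (XT x)); apply: (graph_closed Xc).
  apply/closure_hnorm => d d0; have [x' [y' [/= -> xx yy]]] := cl d d0.
  exists (p x'), (T x'); split=> //.
  by rewrite -(linB pl) (le_lt_trans (proj_hnorm _ pp)).
by exists C => // x; exists (T x).
Qed.

(** Measurability of the adjoint of X, without forming it. With r from [range_support], r kills the
    values of X on ker p, so r X x = r X p x, and X p is bounded. Taking cotrace d / 2 for p pays
    for the factor 2 there. *)
Lemma adjoint_bound X d : tau_measurable M tau X -> 0 < d -> exists r (C : R),
  [/\ projection M r, (tau (id \- r)%R <= d%:E)%E, 0 <= C &
      forall x y, X (x, y) -> hnorm (r y) <= C * hnorm x].
Proof.
move=> [Xc Xa Xd] d0; have d2 : 0 < d / 2 by rewrite divr_gt0.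
have [p [pp tp pX]] := Xd _ d2.
have [C C0 XC] := restriction_bounded Xc pp pX.
have [r [pr tr rX]] := range_support Xc Xa pp.
exists r, C; split=> // [|x y Xxy].
  by apply: (le_trans tr); rewrite (splitr d) EFinD leeD.
have [y' Xpx y'C] := XC x; have pl := proj_linear HM pp.
have : r (y - y') = 0.
  apply: (rX (x - p x)); last by rewrite (linB pl) (proj_idem _ pp) subrr.
  exact: (subspaceB (closed_operator_subspace Xc) Xxy Xpx).
rewrite (linB (proj_linear HM pr)) => /subr0_eq ->.
by rewrite (le_trans (proj_hnorm _ pr)).
Qed.

(** Serves both for closability and for density of domains. *)
Lemma small_complements_eq0 w : (forall d : R, 0 < d -> exists r,
  [/\ projection M r, (tau (id \- r)%R <= d%:E)%E & r w = 0]) -> w = 0.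
Proof.
move=> wr; have /choice[r rP] : forall n : nat, exists r, [/\ projection M r,
    (tau (id \- r)%R <= (n.+1%:R^-1)%:E)%E & r w = 0].
  by move=> n; apply: wr; rewrite invr_gt0.
apply: (small_projections_fix0 HM Htau (r := fun n => id \- r n)) => [n|n|d d0].
- by apply: (proj_compl HM); case: (rP n).
- by case: (rP n) => _ _ /= ->; rewrite subr0.
exists (Num.truncn d^-1); have [_ + _] := rP (Num.truncn d^-1).
move/le_trans; apply; rewrite lee_fin invf_ple ?posrE// ltW//.
exact: truncnS_gt.
Qed.

(** Shared criterion for sums and multiples: the projections p make the closure densely defined and
    measurable, the projections r make it single-valued. *)
Lemma closure_tau_measurable A : A (0, 0) ->
  (forall c x y x' y', A (x, y) -> A (x', y') ->
     A (c *: x + x', c *: y + y')) ->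
  affiliated M A ->
  (forall eps : R, 0 < eps -> exists p, [/\ projection M p,
     (tau (id \- p)%R <= eps%:E)%E & forall x, op_domain A (p x)]) ->
  (forall d : R, 0 < d -> exists r (C : R), [/\ projection M r,
     (tau (id \- r)%R <= d%:E)%E, 0 <= C &
     forall x y, A (x, y) -> hnorm (r y) <= C * hnorm x]) ->
  tau_measurable M tau (closure A).
Proof.
move=> A0 Al Aa Ad Ab; have As := closure_subspace A0 Al.
have Add x : op_domain A x -> op_domain (closure A) x.
  by move=> [y Axy]; exists y; exact: subset_closure.
have A0w w : closure A (0, w) -> w = 0.
  move=> /closure_hnorm cw; apply: small_complements_eq0 => d d0.
  have [r [C [pr tr C0 rC]]] := Ab d d0; exists r; split=> //.
  apply: hnorm_small_eq0 => e e0.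
  have C1 : 0 < C + 1 by rewrite ltr_wpDl.
  have [x [y [Axy]]] := cw _ (divr_gt0 e0 C1); rewrite subr0.
  rewrite !ltr_pdivlMr// => xe ye.
  rewrite -[w](subrK y) (linD (proj_linear HM pr)).
  rewrite (le_trans (hnorm_leD _ _))//.
  have := rC _ _ Axy; have := proj_hnorm (w - y) pr; rewrite (hnormBC w).
  by have := hnorm_ge0 x; nra.
split.
- split=> //.
  + exact: subspace0.
  + by move=> c x y x' y'; exact: (subspace_lin As).
  + move=> x y y' h h'; apply/subr0_eq/A0w.
    by have := subspaceB As h h'; rewrite /GRing.add /= /add_pair /= subrr.
  + exact: subspace_closed.
  + apply: subspace_dense => [|c x y [x' hx] [y' hy]|w wd].
    * by exists 0; exact: subspace0.
    * by exists (c *: x' + y'); exact: (subspace_lin As).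
    (* p w lies in the domain, to which w is orthogonal, so |p w|^2 = <w, p w> = 0. *)
    apply: small_complements_eq0 => d d0; have [p [pp tp pA]] := Ad d d0.
    exists p; split=> //; apply: rdotxx_eq0; rewrite (proj_sq _ pp) rdotC.
    exact/wd/Add.
- move=> u Mu uU x y; have [uu [v [uv [uK vK]]]] := unitaryP uU.
  have ul := commutant_linear Mu.
  split=> /closure_hnorm cl; apply/closure_hnorm => e e0.
    have [x' [y' [Axy xx yy]]] := cl e e0; exists (u x'), (u y').
    by rewrite -!(linB ul) !(unitary_hnorm _ uU); split=> //; exact: (Aa u Mu uU _ _).1.
  have [x' [y' [Axy xx yy]]] := cl e e0; exists (v x'), (v y'); split.
  + by apply/(Aa u Mu uU); rewrite !uK.
  + by rewrite -(unitary_hnorm _ uU) (linB ul) uK.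
  + by rewrite -(unitary_hnorm _ uU) (linB ul) uK.
- move=> eps /Ad[p [pp tp pA]]; exists p; split=> // x.
  exact/Add.
Qed.

Lemma meet_absorb p q e x : projection M p -> is_meet M p q e -> e (p x) = e x.
Proof.
move=> pp [pe ep _ _]; apply: rdot_inj => y.
by rewrite (proj_rdot _ _ pe) (proj_rdot _ _ pp) ep -(proj_rdot _ _ pe).
Qed.

Lemma is_meetC p q e : is_meet M p q e -> is_meet M q p e.
Proof. by case=> pe ep eq eP; split=> // x qx px; exact: eP. Qed.

Lemma meet_small p q d : projection M p -> projection M q ->
  (tau (id \- p)%R <= d%:E)%E -> (tau (id \- q)%R <= d%:E)%E ->
  exists2 e, is_meet M p q e & (tau (id \- e)%R <= (3 * d)%:E)%E.
Proof.
move=> pp pq tp tq; have [e eM te] := meet_ex HM Htau pp pq.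
exists e => //; apply: (le_trans te).
(* One d from p and two from q, by the asymmetric bound of [meet_ex]. *)
have -> : 3 * d = d + (d + d) by ring.
by rewrite !EFinD !leeD.
Qed.

Lemma strong_add_tau_measurable X Y : tau_measurable M tau X ->
  tau_measurable M tau Y -> tau_measurable M tau (strong_add X Y).
Proof.
move=> XM YM; have [Xc Xa Xd] := XM; have [Yc Ya Yd] := YM.
apply: closure_tau_measurable => /=.
- exists 0, 0; split; [exact: graph0|exact: graph0|by rewrite addr0].
- move=> c x _ x' _ [y1 [y2 [X1 Y2 ->]]] [y1' [y2' [X1' Y2' ->]]].
  exists (c *: y1 + y1'), (c *: y2 + y2'); split.
  + exact: (graph_linear Xc).
  + exact: (graph_linear Yc).
  + by rewrite scalerDr addrACA.
- move=> u Mu uU x y; have [uu [v [uv [uK vK]]]] := unitaryP uU.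
  have ul := commutant_linear Mu; split=> /= -[y1 [y2 [Xy Yy yE]]].
    exists (u y1), (u y2); split; [exact: (Xa u Mu uU _ _).1|exact: (Ya u Mu uU _ _).1|].
    by rewrite yE (linD ul).
  exists (v y1), (v y2); split.
  + by apply/(Xa u Mu uU); rewrite uK.
  + by apply/(Ya u Mu uU); rewrite uK.
  + by rewrite -(linD (adjoint_linear uv)) -yE vK.
(* Thirds compensate the factor 3 of [meet_small], here and for the bounding projections below. *)
- move=> eps eps0; have e3 : 0 < eps / 3 by rewrite divr_gt0.
  have [[p [pp tp pX]] [q [pq tq qY]]] := (Xd _ e3, Yd _ e3).
  have [e eM te] := meet_small pp pq tp tq; have [pe ep eq _] := eM.
  exists e; split=> // [|x]; first by apply: le_trans te _; rewrite lee_fin mulrC divfK.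
  have [[y1 h1] [y2 h2]] := (pX (e x), qY (e x)); rewrite ep in h1; rewrite eq in h2.
  by exists (y1 + y2), y1, y2.
- move=> d d0; have d3 : 0 < d / 3 by rewrite divr_gt0.
  have [p [C [pp tp C0 pX]]] := adjoint_bound XM d3.
  have [q [C' [pq tq C'0 qY]]] := adjoint_bound YM d3.
  have [e eM te] := meet_small pp pq tp tq; have [pe _ _ _] := eM.
  exists e, (C + C'); split=> //; first by apply: le_trans te _; rewrite lee_fin mulrC divfK.
    exact: addr_ge0.
  move=> x _ [y1 [y2 [X1 Y2 ->]]]; rewrite (linD (proj_linear HM pe)).
  rewrite -(meet_absorb y1 pp eM) -(meet_absorb y2 pq (is_meetC eM)).
  rewrite (le_trans (hnorm_leD _ _))// mulrDl lerD//.
    by rewrite (le_trans (proj_hnorm _ pe))// pX.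
  by rewrite (le_trans (proj_hnorm _ pe))// qY.
Qed.

(** The case c = 0 needs no separate treatment: the algebraic multiple is zero on a dense domain and
    the closure extends it. *)
Lemma strong_scale_tau_measurable c X : tau_measurable M tau X ->
  tau_measurable M tau (strong_scale c X).
Proof.
move=> XM; have [Xc Xa Xd] := XM; have c0 : 0 <= Normc.normc c.
  by case: (c) => ? ?; exact: sqrtr_ge0.
apply: closure_tau_measurable => /=.
- by exists 0; [exact: graph0|rewrite scaler0].
- move=> d x _ x' _ [y Xy ->] [y' Xy' ->]; exists (d *: y + y').
    exact: (graph_linear Xc).
  by rewrite scalerDr !scalerA mulrC.
- move=> u Mu uU x y; have [uu [v [uv [uK vK]]]] := unitaryP uU.
  have ul := commutant_linear Mu; split=> /= -[y1 Xy yE].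
    by exists (u y1); [exact: (Xa u Mu uU _ _).1|rewrite yE (linZ ul)].
  exists (v y1); first by apply/(Xa u Mu uU); rewrite uK.
  by rewrite -(linZ (adjoint_linear uv)) -yE vK.
- move=> eps /Xd[p [pp tp pX]]; exists p; split=> // x.
  by have [y Xy] := pX x; exists (c *: y), y.
- move=> d /(adjoint_bound XM)[p [C [pp tp C0 pX]]].
  exists p, (Normc.normc c * C); split=> //; first exact: mulr_ge0.
  move=> x _ [y Xy ->]; rewrite (linZ (proj_linear HM pp)) hnormZ -mulrA.
  by rewrite ler_wpM2l// pX.
Qed.

Lemma projection_id : projection M id.
Proof. by split=> //; exact: vn_id. Qed.

Lemma op_zero_tau_measurable : tau_measurable M tau (@op_zero R H).
Proof.
split.
- rewrite /op_zero; split=> //=.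
  + by move=> c x y x' y' /= -> ->; rewrite scaler0 addr0.
  + by move=> x y y' /= -> ->.
  + case=> x y /closure_hnorm cl /=; apply: hnorm_small_eq0 => e /cl.
    by move=> [x' [y' [/= -> _]]]; rewrite sub0r hnorm_opp => /ltW.
  + by apply/dense_hnorm => x e e0; exists x; [exists 0|rewrite subrr hnorm0].
- move=> u Mu uU x y; rewrite /op_zero /=; split=> [->|uy].
    by rewrite (lin0 (commutant_linear Mu)).
  by apply: hnorm_eq0; rewrite -(unitary_hnorm _ uU) uy hnorm0.
- move=> eps e0; exists id; split; first exact: projection_id.
    by rewrite (trace0 HM Htau) lee_fin ltW.
  by move=> x; exists 0.
Qed.

End Measurable.

(** * Estimates for the singular value function *)

Section SingularValues.
Variables (R : realType) (H : hilbertType R) (M : set (H -> H)).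
Hypothesis HM : von_neumann_algebra M.
Variable tau : (H -> H) -> \bar R.
Hypothesis Htau : fns_trace M tau.
Implicit Types (p q e : H -> H) (x y : H) (X Y : set (H * H)) (t C : R).

(** Membership in the set whose infimum is the norm of X p, with the estimate stated in [R]. *)
Definition bounded_by X p C : Prop :=
  0 <= C /\ forall x, exists2 y, X (p x, y) & hnorm y <= C * hnorm x.

Lemma bounded_byE X p C : bounded_by X p C <->
  [set C : R | 0 <= C /\
    forall x, exists2 y, op_comp X p (x, y) & `|y| <= C%:C * `|x|] C.
Proof.
split=> -[C0 XC]; split=> // x; have [y Xy yC] := XC x; exists y => //.
  by rewrite !normr_hnorm -rmorphM lecR.
by move: yC; rewrite !normr_hnorm -rmorphM lecR.
Qed.

Lemma mu_le t X p C : projection M p -> (tau (id \- p)%R <= t%:E)%E ->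
  bounded_by X p C -> (mu M tau t X <= C%:E)%E.
Proof.
move=> pp tp /bounded_byE XC; apply: (@le_trans _ _ (op_norm (op_comp X p))).
  by apply: ereal_inf_lbound; exists p.
by apply: ereal_inf_lbound; exists C.
Qed.

Lemma mu_lt t X C : (mu M tau t X < C%:E)%E -> exists p C',
  [/\ projection M p, (tau (id \- p)%R <= t%:E)%E, bounded_by X p C' & C' < C].
Proof.
move=> /ereal_inf_lt[_ [p [pp tp] <-] /ereal_inf_lt[_ [C' XC' <-]]].
rewrite lte_fin => CC; exists p, C'; split=> //.
exact/bounded_byE.
Qed.

Lemma mu_ge0 t X : (0 <= mu M tau t X)%E.
Proof.
apply: le_ereal_inf_tmp => _ [p _ <-]; apply: le_ereal_inf_tmp => _ [C [C0 _] <-].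
by rewrite lee_fin.
Qed.

Lemma mu_fin_num t X : tau_measurable M tau X -> 0 < t ->
  mu M tau t X \is a fin_num.
Proof.
move=> [Xc _ Xd] /Xd[p [pp tp pX]]; have [C C0 XC] := restriction_bounded HM Xc pp pX.
rewrite ge0_fin_numE ?mu_ge0//; apply: le_lt_trans (ltry C).
by apply: (@mu_le _ _ p).
Qed.

Lemma fine_mu_ge0 t X : 0 <= fine (mu M tau t X).
Proof. by rewrite fine_ge0// mu_ge0. Qed.

(** Near-optimal p for X and q for Y have a meet of cotrace at most 3 t, on which both bounds hold
    and add up. Rounding 3 t up to 4 t keeps powers of two among powers of two. *)
Lemma mu_strong_add t X Y : 0 < t ->
  tau_measurable M tau X -> tau_measurable M tau Y ->
  (mu M tau (4 * t) (strong_add X Y) <= mu M tau t X + mu M tau t Y)%E.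
Proof.
move=> t0 XM YM; have XF := mu_fin_num XM t0; have YF := mu_fin_num YM t0.
rewrite -(fineK XF) -(fineK YF) -EFinD; apply/lee_addgt0Pr => d d0.
rewrite -EFinD; have d2 : 0 < d / 2 by rewrite divr_gt0.
have [|p [C [pp tp [C0 pX] CX]]] := @mu_lt t X (fine (mu M tau t X) + d / 2).
  by rewrite EFinD fineK// lteDl// lte_fin.
have [|q [C' [pq tq [C'0 qY] CY]]] := @mu_lt t Y (fine (mu M tau t Y) + d / 2).
  by rewrite EFinD fineK// lteDl// lte_fin.
have [e [pe ep eq _] te] := meet_small HM Htau pp pq tp tq.
apply: (@le_trans _ _ (C + C')%:E); last by rewrite lee_fin; lra.
apply: (mu_le pe); first by apply: (le_trans te); rewrite lee_fin; lra.
split=> [|x]; first exact: addr_ge0.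
have [y Xy yC] := pX (e x); have [y' Yy' y'C] := qY (e x).
rewrite ep in Xy; rewrite eq in Yy'; exists (y + y').
  by apply: subset_closure; exists y, y'.
have h := proj_hnorm x pe; rewrite mulrDl (le_trans (hnorm_leD _ _))// lerD//.
  by rewrite (le_trans yC)// ler_wpM2l.
by rewrite (le_trans y'C)// ler_wpM2l.
Qed.

Lemma mu_strong_scale c t X : 0 < t -> tau_measurable M tau X ->
  (mu M tau t (strong_scale c X) <= (Normc.normc c * fine (mu M tau t X))%:E)%E.
Proof.
move=> t0 XM; have XF := mu_fin_num XM t0.
have c0 : 0 <= Normc.normc c by case: (c) => ? ?; exact: sqrtr_ge0.
have c1 : 0 < Normc.normc c + 1 by rewrite ltr_wpDl.
apply/lee_addgt0Pr => d d0; have d1 := divr_gt0 d0 c1.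
(* The excess over mu is multiplied by |c|; dividing d by |c| + 1 absorbs it and also covers c =
   0. *)
have [|p [C [pp tp [C0 pX] CX]]] :=
    @mu_lt t X (fine (mu M tau t X) + d / (Normc.normc c + 1)).
  by rewrite EFinD fineK// lteDl// lte_fin.
apply: (@le_trans _ _ (Normc.normc c * C)%:E); last first.
  rewrite -EFinD lee_fin; move: CX; rewrite -ltrBlDl ltr_pdivlMr//.
  set m := fine _; set k := Normc.normc c; rewrite -/k in c0 c1.
  clearbody m k => h; have : k * (C - m) <= d by nra.
  by lra.
apply: (mu_le pp tp); split=> [|x]; first exact: mulr_ge0.
have [y Xy yC] := pX x; exists (c *: y).
  by apply: subset_closure; exists y.
by rewrite hnormZ -mulrA ler_wpM2l.
Qed.

Lemma mu_op_zero t : 0 < t -> mu M tau t (@op_zero R H) = 0%E.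
Proof.
move=> t0; apply/eqP; rewrite eq_le mu_ge0 andbT.
apply: (mu_le (projection_id HM)).
  by rewrite (trace0 HM Htau) lee_fin ltW.
by split=> // x; exists 0; rewrite // hnorm0 mul0r.
Qed.

End SingularValues.

(** * Shift-monotone sequence spaces *)

Section ShiftMonotone.
Variables (R : realType) (E : set (int -> R[i])).
Hypothesis HE : shift_monotone_space E.
Implicit Types (x y : int -> R[i]).

(** Termwise domination passes to the suprema of tails; the tails of x inherit their bounds from
    y. *)
Lemma shift_monotone_dominated x y : E y ->
  (forall k, Normc.normc (x k) <= Normc.normc (y k)) -> E x.
Proof.
move=> Ey xy; have [Eb _ Em _] := HE; have yb := Eb y Ey.
have tail n : ubound (tail_moduli x n) (o_seq y n).
  move=> _ [k nk <-]; apply: (le_trans (xy k)).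
  by apply: ub_le_sup; [exact: yb|exists k].
apply: Em Ey _ => n; first by exists (o_seq y n).
apply: ge_sup => //; exists (Normc.normc (x n)), n => //=.
Qed.

Lemma shift_monotoneD x y : E x -> E y -> E (fun n => x n + y n).
Proof.
move=> Ex Ey; have [_ [_ El] _ _] := HE; have := El 1 x y Ex Ey.
by congr E; apply/funext => n; rewrite mul1r.
Qed.

Lemma shift_monotoneZ c x : E x -> E (fun n => c * x n).
Proof.
move=> Ex; have [_ [E0 El] _ _] := HE; have := El c x _ Ex E0.
by congr E; apply/funext => n; rewrite addr0.
Qed.

Lemma shift_monotone_shift2 x : E x -> E (fun n => x (n - 2)).
Proof.
move=> Ex; have [_ _ _ Es] := HE; have := Es _ (Es _ Ex).
by congr E; apply/funext => n; rewrite /right_shift -addrA -opprD.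
Qed.

End ShiftMonotone.

(** * The Calkin space associated with a shift-monotone space *)

Lemma normc_real (R : realType) (r : R) : 0 <= r -> Normc.normc r%:C = r.
Proof. by move=> r0; rewrite /= expr0n addr0 sqrtr_sqr ger0_norm. Qed.

Theorem mainTheorem2 (R : realType) (H : hilbertType R)
    (Hsep : separable_space H)
    (M : set (H -> H)) (HM : von_neumann_algebra M)
    (tau : (H -> H) -> \bar R) (Htau : fns_trace M tau)
    (EZ : set (int -> R[i])) (HEZ : shift_monotone_space EZ) :
  calkin_space M tau
    [set X : set (H * H) | tau_measurable M tau X /\ EZ (Phi M tau X)].
Proof.
have [_ [E0 _] _ _] := HEZ.
have p2 (n : int) : 0 < (2 : R) ^ n by exact: exprz_gt0.
have finmu X n (XM : tau_measurable M tau X) := mu_fin_num HM XM (p2 n).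
have normPhi X n : Normc.normc (Phi M tau X n) = fine (mu M tau (2 ^ n) X).
  by rewrite /Phi normc_real// fine_mu_ge0.
split; first by move=> X [].
  split.
  - split; first exact: op_zero_tau_measurable.
    by congr EZ: E0; apply/funext => n; rewrite /Phi mu_op_zero.
  - move=> X Y [XM EX] [YM EY]; have XYM := strong_add_tau_measurable HM Htau XM YM.
    (* Since 2^n = 4 * 2^(n-2), the sequence of X + Y is dominated termwise by the sum of the
       sequences of X and Y, each shifted twice. *)
    split => //; apply: (shift_monotone_dominated HEZ
      (shift_monotoneD HEZ (shift_monotone_shift2 HEZ EX)
        (shift_monotone_shift2 HEZ EY))) => n.
    rewrite normPhi /Phi -rmorphD normc_real ?addr_ge0 ?fine_mu_ge0//.
    rewrite -lee_fin EFinD !fineK ?finmu//.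
    have -> : (2 : R) ^ n = 4 * 2 ^ (n - 2).
      have -> : (4 : R) = 2 ^ (2 : int) by rewrite -exprnP; ring.
      by rewrite -expfzDr// addrC subrK.
    exact: mu_strong_add.
  - move=> c X [XM EX]; have cXM := strong_scale_tau_measurable HM Htau c XM.
    split => //; apply: (shift_monotone_dominated HEZ
      (shift_monotoneZ HEZ c EX)) => n.
    rewrite Normc.normcM !normPhi -lee_fin fineK ?finmu//.
    exact: mu_strong_scale.
move=> A B [BM EB] AM AB; split=> //.
apply: (shift_monotone_dominated HEZ EB) => n.
by rewrite !normPhi fine_le ?finmu// AB.
Qed.
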